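(* Let $\mathsf{M}$ be a loopless matroid, let $\mathcal{G}$ be a building set on $\mathcal{L}(\mathsf{M})$, and let $G\in\mathcal{G}$ be such that $\mathcal{G}'=\mathcal{G}\setminus\{G\}$ is also a building set on $\mathcal{L}(\mathsf{M})$. Writing $k=|f(\mathcal{G}'|_G)|$, one has \[ \mathrm{H}_\mathsf{M}^{\mathcal{G}}(x) = \mathrm{H}_\mathsf{M}^{\mathcal{G}'}(x) + (x+x^2+\cdots + x^{k-1})\, \mathrm{H}_{\mathsf{M}|_G}^{\mathcal{G}'|_G}(x)\,\mathrm{H}_{\mathsf{M}/G}^{\mathcal{G}'/G}(x).\]
   Context: A matroid $\mathsf{M}=(E,\operatorname{rk})$: finite $E$, $\operatorname{rk}:2^E\to\mathbb{Z}_{\ge0}$ with $\operatorname{rk}(\varnothing)=0$, monotone, submodular, and $\operatorname{rk}(A)\le|A|$. Flats: $F$ with $\operatorname{rk}(F\cup\{e\})>\operatorname{rk}(F)$ for $e\notin F$; lattice $\mathcal L(\mathsf{M})$ with join $\vee$; loopless: $\varnothing$ is a flat. $f(\mathcal{G})$ = inclusion-maximal elements of a set $\mathcal{G}$ of flats; $\mathcal{G}_{\le F}=\{H\in\mathcal{G}:H\subseteq F\}$. A building set is $\mathcal{G}\subseteq\mathcal L(\mathsf{M})\setminus\{\varnothing\}$ such that for every flat $F$ the map $\prod_{H\in f(\mathcal{G}_{\le F})}[\varnothing,H]\to[\varnothing,F]$, $(F_H)\mapsto\bigvee F_H$, is a lattice isomorphism and $\operatorname{rk}(F)=\sum_{H\in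 f(\mathcal{G}_{\le F})}\operatorname{rk}(H)$. For a flat $G$: $\mathsf{M}|_G=(G,\operatorname{rk}|_{2^G})$ with building set $\mathcal{G}'|_G=\{H\in\mathcal{G}':H\subseteq G\}$; $\mathsf{M}/G$ is the matroid on $E\setminus G$ with rank $A\mapsto\operatorname{rk}(A\cup G)-\operatorname{rk}(G)$, lattice of flats identified with $[G,E]$, with building set $\mathcal{G}'/G=\{H\vee G:H\in\mathcal{G}',H\not\subseteq G\}$. The Chow ring $D(\mathsf{N},\mathcal{B})$ is $\mathbb{Q}[x_B:B\in\mathcal{B}]$ (degree-1 generators) modulo the ideal generated by $\big(\prod_{i=1}^m x_{B_i}\big)\big(\sum_{H\in\mathcal{B},H\supseteq B}x_H\big)^{\operatorname{rk}(B)-\operatorname{rk}(\sup(S,B))}$ for each subset $S=\{B_1,\dots,B_m\}\subseteq\mathcal{B}$ and $B\in\mathcal{B}$, with $\sup(S,B)=\bigvee_{B'\in S,B'\subsetneq B}B'$ (empty join $=\varnothing$); $\mathrm{H}^{\mathcal{B}}_\mathsf{N}(x)=\sum_i\dim D^i(\mathsf{N},\mathcal{B})x^i$, and $\mathrm{H}=1$ for the empty matroid. The sum $x+\cdots+x^{k-1}$ is $0$ if $k\le1$. *)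

(* Defs.v *)
From HB Require Import structures.
From mathcomp Require Import all_boot all_order all_algebra.
From mathcomp Require Import boolp.
From mathcomp Require Import mpoly.

Set Implicit Arguments.
Unset Strict Implicit.
Unset Printing Implicit Defensive.

Import GRing.Theory.

Record matroid (E : finType) := Matroid {
  rk :> {set E} -> nat;
  rk_set0 : rk set0 = 0;
  rk_mono : forall A B : {set E}, A \subset B -> rk A <= rk B;
  rk_submod : forall A B : {set E},
    rk (A :|: B) + rk (A :&: B) <= rk A + rk B;
  rk_le_card : forall A : {set E}, rk A <= #|A|
}.

Section Flats.
Variables (E : finType) (M : matroid E).
Implicit Types (F : {set E}) (Gs : {set {set E}}).

Definition flat F : bool :=
  [forall e, (e \notin F) ==> (rk M F < rk M (e |: F))].

Definition flats : {set {set E}} := [set F | flat F].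

Definition loopless : bool := flat set0.

(* The smallest flat containing A.  The join of a family of flats is [cl] of
   its union; when M is loopless the empty join is [cl set0 = set0]. *)
Definition cl (A : {set E}) : {set E} :=
  \bigcap_(F in flats | A \subset F) F.

Definition below Gs F : {set {set E}} := [set H in Gs | H \subset F].

Definition maxel Gs : {set {set E}} :=
  [set H in Gs | [forall K in Gs, ~~ (H \proper K)]].

(* The interval [set0, F] of the lattice of flats of a loopless matroid. *)
Definition lower F : {set {set E}} := below flats F.

(* The product of the intervals [set0, H] for H in D: families indexed by all
   sets, with the dummy value [set0] outside D. *)
Definition lower_prod (D : {set {set E}}) :
    {pred {ffun {set E} -> {set E}}} :=
  pfamily set0 (mem D) (fun H => mem (lower H)).

Definition join_map (D : {set {set E}}) (phi : {ffun {set E} -> {set E}}) :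
    {set E} := cl (\bigcup_(H in D) phi H).

(* [join_map D] is a lattice isomorphism from the product of the intervals
   [set0, H], H in D, onto [set0, F]; the meet of two flats is their
   intersection. *)
Definition join_map_iso (D : {set {set E}}) F : Prop :=
  [/\ {in lower_prod D &, injective (join_map D)},
      [set join_map D phi | phi in lower_prod D] = lower F,
      {in lower_prod D &, forall phi psi : {ffun {set E} -> {set E}},
         join_map D [ffun H => phi H :&: psi H] =
         join_map D phi :&: join_map D psi}
    & {in lower_prod D &, forall phi psi : {ffun {set E} -> {set E}},
         join_map D [ffun H => cl (phi H :|: psi H)] =
         cl (join_map D phi :|: join_map D psi)}].

Definition building_set Gs : Prop :=
  Gs \subset flats :\ set0 /\
  forall F, F \in flats ->
    join_map_iso (maxel (below Gs F)) F /\
    rk M F = \sum_(H in maxel (below Gs F)) rk M H.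

End Flats.

Section Minors.
Variables (E : finType) (M : matroid E) (G : {set E}).

Definition restr_rk (A : {set {x : E | x \in G}}) : nat := rk M (val @: A).

Fact restr_rk0 : restr_rk set0 = 0.
Proof. by rewrite /restr_rk imset0 rk_set0. Qed.

Fact restr_rk_mono (A B : {set {x : E | x \in G}}) :
  A \subset B -> restr_rk A <= restr_rk B.
Proof. by move=> AB; apply/rk_mono/imsetS. Qed.

Fact restr_rk_submod (A B : {set {x : E | x \in G}}) :
  restr_rk (A :|: B) + restr_rk (A :&: B) <= restr_rk A + restr_rk B.
Proof.
rewrite /restr_rk imsetU imsetI; first exact: rk_submod.
by move=> x y _ _; apply: val_inj.
Qed.

Fact restr_rk_card (A : {set {x : E | x \in G}}) : restr_rk A <= #|A|.
Proof. exact: leq_trans (rk_le_card M _) (leq_imset_card _ _). Qed.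

Definition restr : matroid {x : E | x \in G} :=
  Matroid restr_rk0 restr_rk_mono restr_rk_submod restr_rk_card.

Definition contr_rk (A : {set {x : E | x \notin G}}) : nat :=
  rk M (val @: A :|: G) - rk M G.

Fact contr_rk0 : contr_rk set0 = 0.
Proof. by rewrite /contr_rk imset0 set0U subnn. Qed.

Fact contr_rk_mono (A B : {set {x : E | x \notin G}}) :
  A \subset B -> contr_rk A <= contr_rk B.
Proof. by move=> AB; apply/leq_sub2r/rk_mono/setSU/imsetS. Qed.

Fact contr_rk_submod (A B : {set {x : E | x \notin G}}) :
  contr_rk (A :|: B) + contr_rk (A :&: B) <= contr_rk A + contr_rk B.
Proof.
have leG (C : {set E}) : rk M G <= rk M (C :|: G) by apply/rk_mono/subsetUr.
rewrite /contr_rk -(leq_add2r (rk M G + rk M G)) !(addnACA _ _ (rk M G)).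
rewrite !subnK //.
rewrite imsetU imsetI; last by move=> x y _ _; apply: val_inj.
by have := rk_submod M (val @: A :|: G) (val @: B :|: G);
  rewrite -setUUl -setUIl.
Qed.

Fact contr_rk_card (A : {set {x : E | x \notin G}}) : contr_rk A <= #|A|.
Proof.
rewrite leq_subLR addnC; apply: leq_trans (leq_add (_ : rk M (val @: A) <= _)
  (leqnn _)); last exact: leq_trans (rk_le_card M _) (leq_imset_card _ _).
exact: leq_trans (leq_addr _ _) (rk_submod M _ _).
Qed.

Definition contr : matroid {x : E | x \notin G} :=
  Matroid contr_rk0 contr_rk_mono contr_rk_submod contr_rk_card.

Definition restr_bs (Gs : {set {set E}}) : {set {set {x : E | x \in G}}} :=
  [set [set x | val x \in H] | H : {set E} in below Gs G].

(* A flat F of M containing G is identified with the flat F minus G of M/G. *)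
Definition contr_bs (Gs : {set {set E}}) : {set {set {x : E | x \notin G}}} :=
  [set [set x | val x \in cl M (H :|: G)]
     | H : {set E} in [set H in Gs | ~~ (H \subset G)]].

End Minors.

Local Open Scope ring_scope.
Local Open Scope quotient_scope.

(* The library's [{ideal_quot I}] needs I to be proper; here I is the ideal
   generated by an arbitrary finite family and the quotient may be zero. *)
Section PresentedAlgebra.
Variables (K : fieldType) (n : nat) (J : finType) (g : J -> {mpoly K[n]}).

Definition ideal_gen : {pred {mpoly K[n]}} :=
  fun p => `[< exists c : J -> {mpoly K[n]}, p = \sum_j c j * g j >].

Lemma ideal_genP p :
  reflect (exists c : J -> {mpoly K[n]}, p = \sum_j c j * g j)
          (p \in ideal_gen).
Proof. exact: asboolP. Qed.

Lemma ideal_gen_zmod : zmod_closed ideal_gen.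
Proof.
split=> [|p q /ideal_genP[c ->] /ideal_genP[d ->]]; apply/ideal_genP.
  by exists (fun=> 0); rewrite big1 // => j _; rewrite mul0r.
exists (fun j => c j - d j); rewrite -sumrB.
by apply: eq_bigr => j _; rewrite mulrBl.
Qed.
HB.instance Definition _ := GRing.isZmodClosed.Build _ ideal_gen ideal_gen_zmod.

Lemma ideal_genMl p q : q \in ideal_gen -> p * q \in ideal_gen.
Proof.
move=> /ideal_genP[c ->]; apply/ideal_genP; exists (fun j => p * c j).
by rewrite mulr_sumr; apply: eq_bigr => j _; rewrite mulrA.
Qed.

Lemma ideal_gen_mem j : g j \in ideal_gen.
Proof.
apply/ideal_genP; exists (fun i => (i == j)%:R).
rewrite (bigD1 j) //= eqxx mul1r big1 ?addr0 // => i /negPf->.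
by rewrite mul0r.
Qed.

Definition pres_alg := Quotient.quot ideal_gen.
HB.instance Definition _ := GRing.Zmodule.on pres_alg.

Definition pres_pi (p : {mpoly K[n]}) : pres_alg := \pi_(Quotient.quot ideal_gen) p.

Lemma pres_pi_eq p q : (pres_pi p == pres_pi q) = (p - q \in ideal_gen).
Proof. by rewrite /pres_pi Quotient.idealrBE. Qed.

Lemma pres_pi_eq0 p : (pres_pi p == 0) = (p \in ideal_gen).
Proof. by rewrite -{2}[p]subr0 -pres_pi_eq /pres_pi raddf0. Qed.

Lemma pres_piK (u : pres_alg) : pres_pi (repr u) = u.
Proof. exact: reprK. Qed.

Lemma pres_pi_is_zmod : zmod_morphism pres_pi.
Proof. by move=> p q; rewrite /pres_pi raddfB. Qed.
HB.instance Definition _ :=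
  GRing.isZmodMorphism.Build _ _ pres_pi pres_pi_is_zmod.

Definition pres_one : pres_alg := pres_pi 1.
Definition pres_mul (u v : pres_alg) : pres_alg := pres_pi (repr u * repr v).
Definition pres_scale (a : K) (u : pres_alg) : pres_alg :=
  pres_pi (a *: repr u).

Lemma pres_repr p : repr (pres_pi p) - p \in ideal_gen.
Proof. by rewrite -pres_pi_eq pres_piK. Qed.

Lemma pres_piM p q : pres_pi (p * q) = pres_mul (pres_pi p) (pres_pi q).
Proof.
apply/esym/eqP; rewrite pres_pi_eq.
set p' := repr _; set q' := repr _.
have -> : p' * q' - p * q = p' * (q' - q) + q * (p' - p).
  by rewrite !mulrBr [q * p]mulrC [q * p']mulrC addrA subrK.
by rewrite rpredD // ideal_genMl ?pres_repr.
Qed.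

Lemma pres_piZ a p : pres_pi (a *: p) = pres_scale a (pres_pi p).
Proof.
apply/esym/eqP; rewrite pres_pi_eq -scalerBr -mul_mpolyC.
by rewrite ideal_genMl ?pres_repr.
Qed.

Fact pres_mulA : associative pres_mul.
Proof.
move=> u v w; rewrite -[u]pres_piK -[v]pres_piK -[w]pres_piK.
by rewrite -!pres_piM mulrA.
Qed.
Fact pres_mulC : commutative pres_mul.
Proof. by move=> u v; rewrite /pres_mul mulrC. Qed.
Fact pres_mul1 : left_id pres_one pres_mul.
Proof. by move=> u; rewrite -[u]pres_piK -pres_piM mul1r. Qed.
Fact pres_mulDl : left_distributive pres_mul +%R.
Proof.
move=> u v w; rewrite -[u]pres_piK -[v]pres_piK -[w]pres_piK.
by rewrite -raddfD -!pres_piM mulrDl raddfD.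
Qed.
HB.instance Definition _ := GRing.Zmodule_isComPzRing.Build pres_alg
  pres_mulA pres_mulC pres_mul1 pres_mulDl.

Fact pres_pi_is_monoid : monoid_morphism pres_pi.
Proof. by split=> // p q; rewrite pres_piM. Qed.
HB.instance Definition _ :=
  GRing.isMonoidMorphism.Build _ _ pres_pi pres_pi_is_monoid.

Fact pres_scaleA a b u :
  pres_scale a (pres_scale b u) = pres_scale (a * b) u.
Proof. by rewrite -[u]pres_piK -!pres_piZ scalerA. Qed.
Fact pres_scale1 : left_id 1 pres_scale.
Proof. by move=> u; rewrite -[u]pres_piK -pres_piZ scale1r. Qed.
Fact pres_scaleDr : right_distributive pres_scale +%R.
Proof.
move=> a u v; rewrite -[u]pres_piK -[v]pres_piK -raddfD -!pres_piZ.
by rewrite scalerDr raddfD.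
Qed.
Fact pres_scaleDl u : {morph pres_scale^~ u : a b / a + b}.
Proof. by move=> a b; rewrite -[u]pres_piK -!pres_piZ scalerDl raddfD. Qed.
HB.instance Definition _ := GRing.Zmodule_isLmodule.Build K pres_alg
  pres_scaleA pres_scale1 pres_scaleDr pres_scaleDl.

Fact pres_pi_is_scalable : scalable pres_pi.
Proof. by move=> a p; rewrite pres_piZ. Qed.
HB.instance Definition _ :=
  GRing.isScalable.Build K _ _ *:%R pres_pi pres_pi_is_scalable.

End PresentedAlgebra.

(* The linear subspace U of V has dimension k. *)
Definition has_dim (K : fieldType) (V : lmodType K) (U : V -> Prop) (k : nat) :
    Prop :=
  exists e : 'I_k -> V,
    [/\ forall i, U (e i),
        forall c : 'I_k -> K, \sum_i c i *: e i = 0 -> forall i, c i = 0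
      & forall u, U u -> exists c : 'I_k -> K, u = \sum_i c i *: e i].

Lemma has_dim_span (K : fieldType) (V : lmodType K) (s : seq V) (U : V -> Prop) :
  {in s, forall v, U v} ->
  (forall u, U u -> exists c : V -> K, u = \sum_(v <- s) c v *: v) ->
  exists k, has_dim U k.
Proof.
move=> sU Us.
have [k [e [eU ef es]]] : exists k (e : 'I_k -> V),
   [/\ forall i, U (e i),
       forall c : 'I_k -> K, \sum_i c i *: e i = 0 -> forall i, c i = 0
     & {in s, forall u, exists c : 'I_k -> K, u = \sum_i c i *: e i}].
  elim: s sU {Us} => [|v s IH] sU.
    by exists 0%N, (fun=> 0); split=> [[]|c _ []|].
  have [w ws|k [e [eU ef es]]] := IH.
    by apply: sU; rewrite inE ws orbT.
  have [[c vc]|vN] := pselect (exists c : 'I_k -> K, v = \sum_i c i *: e i).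
    exists k, e; split=> // w; rewrite inE => /predU1P[->|/es//].
    by exists c.
  exists k.+1, (fun i => oapp e v (unlift ord0 i)); split.
  - by move=> i; case: unliftP => [j|] _ //=; apply/sU/mem_head.
  - move=> c; rewrite big_ord_recl unlift_none /=.
    under eq_bigr do rewrite liftK /=.
    move=> c0; have c00 : c ord0 = 0.
      apply/eqP/negPn/negP => nz; apply: vN.
      exists (fun i => - (c ord0)^-1 * c (lift ord0 i)).
      under eq_bigr do rewrite -scalerA.
      rewrite -scaler_sumr; move/eqP: c0; rewrite addrC addr_eq0 => /eqP->.
      by rewrite scalerN scaleNr opprK scalerA mulVf ?scale1r.
    move: c0; rewrite c00 scale0r add0r => /ef cl0 i.
    by case: (unliftP ord0 i) => [j ->|->].
  - have ext (c : 'I_k -> K) a : exists d : 'I_k.+1 -> K,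
        a *: v + \sum_i c i *: e i =
        \sum_i d i *: oapp e v (unlift ord0 i).
      exists (fun i => oapp c a (unlift ord0 i)).
      rewrite big_ord_recl unlift_none /=; congr (_ + _).
      by apply: eq_bigr => i _; rewrite liftK.
    move=> w; rewrite inE => /predU1P[->|/es[c ->]].
      have [d dE] := ext (fun=> 0) 1; exists d; rewrite -dE scale1r big1 ?addr0 //.
      by move=> i _; rewrite scale0r.
    have [d dE] := ext c 0; exists d; rewrite -dE scale0r add0r //.
exists k, e; split=> // u /Us[c ->].
elim: s es {sU Us} => [|v s IH] es.
  by exists (fun=> 0); rewrite big_nil big1 // => i _; rewrite scale0r.
have [a aE] := es v (mem_head _ _).
have [w ws|b bE] := IH; first by apply: es; rewrite inE ws orbT.
exists (fun i => c v * a i + b i); rewrite big_cons bE {2}aE scaler_sumr.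
by rewrite -big_split; apply: eq_bigr => i _; rewrite scalerDl scalerA.
Qed.

Lemma nilp_sub (R : comPzRingType) (a b : R) p q :
  a ^+ p = 0 -> b ^+ q = 0 -> (a - b) ^+ (p + q) = 0.
Proof.
move=> a0 b0; rewrite exprDn big1 // => i _.
have [/subnK <-|iq] := leqP q i.
  by rewrite exprNn (exprD b) b0 !mulr0 mul0rn.
have /subnK <- : (p <= p + q - i)%N by rewrite -addnBA ?leq_addr // ltnW.
by rewrite (exprD a) a0 mulr0 mul0r mul0rn.
Qed.

Lemma nilp_sum (R : comPzRingType) (I : finType) (P : pred I) (F : I -> R) :
  (forall i, P i -> exists q, F i ^+ q = 0) ->
  exists q, (\sum_(i | P i) F i) ^+ q = 0.
Proof.
move=> FN; elim/big_ind: _ => //; first by exists 1%N; rewrite expr1.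
move=> a b [p a0] [q b0]; exists (p + q)%N; rewrite -[b]opprK.
by apply: nilp_sub; rewrite // exprNn b0 mulr0.
Qed.

Section ChowRing.
Variables (E : finType) (N : matroid E) (Bs : {set {set E}}).

(* The variable x_B is ['X_i] for the index i of B in Bs, so that subsets of
   Bs are sets of indices. *)
Definition bflat (i : 'I_#|Bs|) : {set E} := enum_val i.

Definition chow_sup (S : {set 'I_#|Bs|}) (b : 'I_#|Bs|) : {set E} :=
  cl N (\bigcup_(i in S | bflat i \proper bflat b) bflat i).

Definition chow_rel (Sb : {set 'I_#|Bs|} * 'I_#|Bs|) : {mpoly rat[#|Bs|]} :=
  (\prod_(i in Sb.1) 'X_i) *
  (\sum_(i | bflat Sb.2 \subset bflat i) 'X_i)
    ^+ (rk N (bflat Sb.2) - rk N (chow_sup Sb.1 Sb.2)).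

Definition chow_ring := pres_alg chow_rel.

(* The degree i piece, the image of the homogeneous polynomials. *)
Definition chow_piece (i : nat) (u : chow_ring) : Prop :=
  exists2 p : {mpoly rat[#|Bs|]}, p \is i.-homog & u = pres_pi chow_rel p.

Lemma chow_piece_fin i : exists k, has_dim (@chow_piece i) k.
Proof.
pose ms := [seq m <- [seq bmnm m | m : 'X_{1..#|Bs| < i.+1}] | mdeg m == i].
pose s := undup [seq pres_pi chow_rel 'X_[m] | m <- ms].
apply: (@has_dim_span _ _ s) => [v|u [p ph ->]].
  rewrite mem_undup => /mapP[m]; rewrite mem_filter => /andP[mi _] ->.
  by exists 'X_[m] => //; rewrite dhomogX.
rewrite [p]mpolyE raddf_sum /=.
have : {subset msupp p <= ms}.
  move=> m /(dhomogP _ _ _ ph) mi; rewrite mem_filter mi eqxx /=.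
  have mi' : (mdeg m < i.+1)%N by rewrite mi.
  by apply/imageP; exists (BMultinom mi').
move: (msupp p); elim=> [|m r IH] rms.
  by exists (fun=> 0); rewrite big_nil big1 // => v _; rewrite scale0r.
have [m' m'r|c cE] := IH; first by apply: rms; rewrite inE m'r orbT.
exists (fun v => (if v == pres_pi chow_rel 'X_[m] then p@_m else 0) + c v).
rewrite big_cons cE linearZ /=.
under [RHS]eq_bigr do rewrite scalerDl.
rewrite big_split /=; congr (_ + _).
rewrite (bigD1_seq (pres_pi chow_rel 'X_[m])) ?undup_uniq //=; last first.
  by rewrite mem_undup; apply: (map_f (fun m => pres_pi chow_rel 'X_[m]));
    apply/rms/mem_head.
by rewrite eqxx big1 ?addr0 // => v /negPf->; rewrite scale0r.
Qed.

Lemma chow_var_nilp (b : 'I_#|Bs|) :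
  exists q, pres_pi chow_rel 'X_b ^+ q = 0.
Proof.
have [t] := ubnP (#|E| - #|bflat b|)%N.
elim: t b => // t IH b; rewrite ltnS => bt.
have [q yq] : exists q, (\sum_(i | bflat b \subset bflat i)
                           pres_pi chow_rel 'X_i) ^+ q = 0.
  exists (rk N (bflat b) - rk N (chow_sup set0 b))%N.
  apply/eqP; rewrite -raddf_sum -rmorphXn /= pres_pi_eq0.
  by have := ideal_gen_mem chow_rel (set0, b); rewrite {1}/chow_rel big_set0 mul1r.
have [r zr] : exists r, (\sum_(i | (bflat b \subset bflat i) && (i != b))
                           pres_pi chow_rel 'X_i) ^+ r = 0.
  apply: nilp_sum => i /andP[bi ib]; apply: IH; apply: leq_trans bt.
  have pbi : bflat b \proper bflat i.
    rewrite properEneq bi andbT; apply: contraNneq ib.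
    by move=> /enum_val_inj ->.
  apply: ltn_sub2l; last exact: proper_card.
  exact: leq_trans (proper_card pbi) (max_card _).
exists (q + r)%N; move: yq; rewrite (bigD1 b) //= => yq.
by rewrite -(nilp_sub yq zr) addrK.
Qed.

Lemma chow_hilbert_ex :
  exists h : {poly nat}, forall i, has_dim (@chow_piece i) (h`_i)%R.
Proof.
have [q qN] := choice chow_var_nilp.
have [d dE] := choice chow_piece_fin.
exists (\poly_(i < (\sum_b q b).+1) d i) => i; rewrite coef_poly.
case: ltnP => [_|qi]; first exact: dE.
exists (fun=> 0); split=> [[]|c _ []|u [p ph ->]] //; exists (fun=> 0).
rewrite big_ord0 [p]mpolyE raddf_sum /= big_seq big1 // => m.
move=> /(dhomogP _ _ _ ph) /= mi.
have [b qb] : exists b, (q b <= m b)%N.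
  apply/existsP; apply: contraTT qi; rewrite negb_exists -leqNgt -mi => /forallP H.
  by rewrite mdegE leq_sum // => b _; rewrite ltnW // ltnNge.
rewrite linearZ mpolyXE_id rmorph_prod /= (bigD1 b) //= rmorphXn /=.
by rewrite -(subnK qb) exprD qN mulr0 mul0r scaler0.
Qed.

(* The polynomial sum_i (dim D^i) x^i. *)
Definition hilb : {poly nat} := sval (cid chow_hilbert_ex).

Lemma hilbP i : has_dim (@chow_piece i) (hilb`_i)%R.
Proof. exact: (svalP (cid chow_hilbert_ex)). Qed.

End ChowRing.

(* Main.v *)
Require Import Defs.
From HB Require Import structures.
From mathcomp Require Import all_boot all_order all_algebra.
From mathcomp Require Import boolp mpoly.
Set Implicit Arguments.
Unset Strict Implicit.
Unset Printing Implicit Defensive.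
Import GRing.Theory.
Local Open Scope ring_scope.

(* The passage from Gs' = Gs minus G to Gs is a blow-up, and the recursion is
   Keel's formula for its Chow ring.  Let h_1, ..., h_k be the maximal elements of
   Gs' below G, and let J be the ideal of D(M, Gs') of the classes vanishing on the
   centre, the intersection of the divisors x_{h_i}.  Substituting x_{h_i} + x_G
   for x_{h_i} one finds
     D(M, Gs) = D(M, Gs')[t] / (t J, (t - x_{h_1}) ... (t - x_{h_k})),  t = x_G,
   and x_{h_1} ... x_{h_k} annihilates J, so that D(M, Gs) is the direct sum of
   D(M, Gs') and of t^r D(M, Gs')/J for 0 < r < k.  Moreover D(M, Gs')/J is the
   tensor product of the Chow rings of M|G and M/G.  Both isomorphisms are checked
   on the presentations by generators and relations; no basis of the Chow rings
   is needed. *)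

(** Two facts carry the argument. The factors h of [G] are disjoint as sets, so an element of [Gs']
    below [G] lies below exactly one of them, and any other element below none. Hence replacing x_h
    by x_h + x_G carries the sum of the variables above B to the same sum for [Gs], for every B in
    [Gs']: only the monomial part of a relation changes. Secondly, P = (X - x_{h_1}) ... (X -
    x_{h_k}) is monic and its constant term is, up to sign, the monomial that annihilates J. So
    remainders on division by P are unique, with constant coefficient taken in D(M, Gs') and the k -
    1 others taken modulo J. The obstacle is the relations of D(M, Gs) at B = G, whose exponent has
    to be shared out among the factors; this uses that rk G is the sum of the rk h. In both
    isomorphisms freeness of a basis is read off through the inverse map ([psi], [rho]), and
    spanning is obtained by rewriting one variable at a time. *)

Section Ideals.
Variable R : comNzRingType.
Implicit Types (I : R -> Prop) (a b c : R).

Definition is_ideal I : Prop :=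
  [/\ I 0, forall a b, I a -> I b -> I (a + b) & forall a b, I b -> I (a * b)].

Inductive ideal_span (gen : R -> Prop) : R -> Prop :=
| ideal_span_gen a : gen a -> ideal_span gen a
| ideal_span0 : ideal_span gen 0
| ideal_spanD a b :
    ideal_span gen a -> ideal_span gen b -> ideal_span gen (a + b)
| ideal_spanM a b : ideal_span gen b -> ideal_span gen (a * b).

Lemma ideal_span_ideal gen : is_ideal (ideal_span gen).
Proof.
by split; [apply: ideal_span0|apply: ideal_spanD|apply: ideal_spanM].
Qed.

Lemma ideal_span_sub gen I :
  is_ideal I -> (forall a, gen a -> I a) -> forall a, ideal_span gen a -> I a.
Proof. by move=> [I0 ID IM] gI a; elim; eauto. Qed.

Variable I : R -> Prop.
Hypothesis II : is_ideal I.

Lemma ideal0 : I 0. Proof. by case: II. Qed.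

Lemma idealD a b : I a -> I b -> I (a + b).
Proof. by case: II => _ + _; apply. Qed.

Lemma idealMl a b : I b -> I (a * b). Proof. by case: II => _ _; apply. Qed.

Lemma idealMr a b : I a -> I (a * b).
Proof. by rewrite mulrC; apply: idealMl. Qed.

Lemma idealN a : I a -> I (- a).
Proof. by rewrite -mulN1r; apply: idealMl. Qed.

Lemma idealB a b : I a -> I b -> I (a - b).
Proof. by move=> Ia Ib; apply: idealD => //; apply: idealN. Qed.

Lemma ideal_eq a b : I (a - b) -> I b -> I a.
Proof. by move=> Iab Ib; rewrite -(subrK b a); apply: idealD. Qed.

Lemma ideal_sum (T : Type) (r : seq T) (P : pred T) (F : T -> R) :
  (forall i, P i -> I (F i)) -> I (\sum_(i <- r | P i) F i).
Proof. by move=> IF; apply: big_ind => //; [apply: ideal0|apply: idealD]. Qed.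

Lemma ideal_prod_congr (T : Type) (r : seq T) (P : pred T) (F G : T -> R) :
  (forall i, P i -> I (F i - G i)) ->
  I (\prod_(i <- r | P i) F i - \prod_(i <- r | P i) G i).
Proof.
move=> IFG; elim: r => [|i r IH]; first by rewrite !big_nil subrr; apply: ideal0.
rewrite !big_cons; case: ifP => // /IFG Ii.
set p := \prod_(_ <- _ | _) _ in IH *; set q := \prod_(_ <- _ | _) _ in IH *.
have -> : F i * p - G i * q = (F i - G i) * p + G i * (p - q).
  by rewrite mulrBl mulrBr addrA subrK.
by apply: idealD; [apply: idealMr|apply: idealMl].
Qed.

Lemma ideal_exp_congr c a b e : I (c * (a - b)) -> I (c * (a ^+ e - b ^+ e)).
Proof. by move=> Iab; rewrite subrXX mulrA; apply: idealMr. Qed.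

End Ideals.

(** The cofactor of [t] may stay unspecified: in each use [t] times the remaining factors already
    lies in the ideal. *)
Lemma prodDE (R : comNzRingType) (T : Type) (r : seq T) (P : pred T)
    (a b : T -> R) (t : R) :
  exists u, \prod_(i <- r | P i) (a i + b i * t) =
            \prod_(i <- r | P i) a i + t * u.
Proof.
elim: r => [|i r [u IH]]; first by exists 0; rewrite !big_nil mulr0 addr0.
rewrite !big_cons; case: ifP => _; last by exists u.
set p := \prod_(_ <- _ | _) a _ in IH *.
exists (a i * u + b i * (p + t * u)); rewrite IH.
by rewrite mulrDl !mulrDr !addrA !mulrA ![t * _]mulrC.
Qed.

(** * Bases of graded pieces of quotients, on the level of polynomials *)

Section HomogeneousBases.
Variable K : fieldType.

(** Homogeneous lifts of a basis of the degree [d] piece of the quotient by [I]; no quotient ring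
    has to be built for each ideal. The index type is arbitrary because the bases below are indexed
    by sums and dependent pairs. *)
Definition hbasis n (I : {mpoly K[n]} -> Prop) d (T : finType)
    (e : T -> {mpoly K[n]}) : Prop :=
  [/\ forall i, e i \is d.-homog,
      forall c : T -> K, I (\sum_i c i *: e i) -> forall i, c i = 0
    & forall p, p \is d.-homog -> exists c : T -> K,
        I (p - \sum_i c i *: e i)].

Definition hdim n (I : {mpoly K[n]} -> Prop) d k : Prop :=
  exists e : 'I_k -> {mpoly K[n]}, hbasis I d e.

Lemma hbasis_hdim n (I : {mpoly K[n]} -> Prop) d (T : finType)
    (e : T -> {mpoly K[n]}) : hbasis I d e -> hdim I d #|T|.
Proof.
move=> [eh ef es]; exists (fun i => e (enum_val i)); split=> [i|c|p ph].
- exact: eh.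
- have -> : \sum_i c i *: e (enum_val i) = \sum_x c (enum_rank x) *: e x.
    rewrite [RHS](reindex (@enum_val T predT)) /=; last first.
      by apply: onW_bij; apply: enum_val_bij.
    by apply: eq_bigr => i _; rewrite enum_valK.
  by move=> /ef c0 i; rewrite -[i]enum_valK; apply: c0.
- have [c Ic] := es p ph; exists (fun i => c (enum_val i)).
  rewrite (_ : \sum_i _ = \sum_x c x *: e x) //.
  by rewrite [RHS](reindex (@enum_val T predT)) //; apply: onW_bij;
    apply: enum_val_bij.
Qed.

(** The coordinates of the second family in the first form an [l] by [k] matrix; a relation among
    its rows would be a relation of the second family modulo [I], so its rank is [l]. *)
Lemma hdim_leq n (I : {mpoly K[n]} -> Prop) d k l :
  is_ideal I -> hdim I d k -> hdim I d l -> (l <= k)%N.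
Proof.
move=> II [e [_ _ es]] [f [fh ff _]].
have [C CE] := choice (fun j => es _ (fh j)).
pose A : 'M_(l, k) := \matrix_(j, i) C j i.
have : row_free A.
  apply: inj_row_free => v vA; apply/rowP => j; rewrite mxE.
  apply: (ff (fun j => v 0 j)); apply: (@ideal_eq _ _ II _ (\sum_i (v *m A) 0 i *: e i)); last first.
    by rewrite vA big1 => [|i _]; [apply: ideal0|rewrite mxE scale0r].
  have -> : \sum_i (v *m A) 0 i *: e i =
            \sum_j v 0 j *: \sum_i C j i *: e i.
    under [RHS]eq_bigr do rewrite scaler_sumr; rewrite exchange_big /=.
    apply: eq_bigr => i _; rewrite mxE scaler_suml.
    by apply: eq_bigr => j' _; rewrite mxE scalerA.
  rewrite -sumrB; apply: ideal_sum => // j' _.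
  by rewrite -scalerBr -mul_mpolyC; apply: idealMl.
by rewrite /row_free => /eqP <-; apply: rank_leq_col.
Qed.

Lemma hdim_uniq n (I : {mpoly K[n]} -> Prop) d k l :
  is_ideal I -> hdim I d k -> hdim I d l -> k = l.
Proof. by move=> II hk hl; apply/eqP; rewrite eqn_leq !(@hdim_leq _ I d). Qed.

Lemma ideal_gen_ideal n (J : finType) (g : J -> {mpoly K[n]}) :
  is_ideal (fun p => p \in ideal_gen g).
Proof.
split=> [|a b|a b]; [exact: rpred0|exact: rpredD|exact: ideal_genMl].
Qed.

End HomogeneousBases.

(** From here on Hilbert functions are seen only through [hdim]. *)
Lemma hilb_hdim (E : finType) (N : matroid E) Bs d :
  hdim (fun p => p \in ideal_gen (chow_rel N (Bs := Bs))) d ((hilb N Bs)`_d)%R.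
Proof.
have [e [eU ef es]] := hilbP N Bs d.
have [r rE] := choice (fun i => (let: ex_intro2 p ph pe := eU i in
  ex_intro (fun p => p \is d.-homog /\ e i = pres_pi _ p) p (conj ph pe))).
have piE c : \sum_i c i *: e i = pres_pi _ (\sum_i c i *: r i).
  by rewrite linear_sum; apply: eq_bigr => i _; rewrite linearZ (rE i).2.
exists r; split=> [i|c cI|p ph]; first exact: (rE i).1.
  by apply: ef; apply/eqP; rewrite piE pres_pi_eq0.
have [|c cE] := es (pres_pi _ p); first by exists p.
by exists c; rewrite -pres_pi_eq cE piE.
Qed.

Section HomogeneousSpan.
Variables (K : fieldType) (n : nat).
Implicit Types (p q : {mpoly K[n]}).

Lemma mpolyX_prod_seq (m : 'X_{1..n}) :
  exists2 s : seq 'I_n, size s = mdeg m &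
    'X_[m] = \prod_(i <- s) 'X_i :> {mpoly K[n]}.
Proof.
exists (flatten [seq nseq (m i) i | i <- enum 'I_n]).
  rewrite size_flatten /shape -map_comp mdegE sumnE big_map big_enum /=.
  by apply: eq_bigr => i _; rewrite size_nseq.
rewrite mpolyXE_id big_flatten /= big_map big_enum /=.
by apply: eq_bigr => i _; rewrite big_nseq iter_mulr_1.
Qed.

(** Monomials are written as products over sequences so that spanning proofs can peel off one
    variable at a time. *)
Lemma homog_ind (d : nat) (Sp : {mpoly K[n]} -> Prop) :
  Sp 0 -> (forall p q, Sp p -> Sp q -> Sp (p + q)) ->
  (forall c p, Sp p -> Sp (c *: p)) ->
  (forall s : seq 'I_n, size s = d -> Sp (\prod_(i <- s) 'X_i)) ->
  forall p, p \is d.-homog -> Sp p.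
Proof.
move=> S0 SD SZ SX p ph; rewrite [p]mpolyE big_seq.
apply: big_ind => // m /(dhomogP _ _ _ ph) md; apply: SZ.
by have [s ss ->] := mpolyX_prod_seq m; apply: SX; rewrite ss md.
Qed.

Lemma dhomogM_eq d1 d2 d p q : p \is d1.-homog -> q \is d2.-homog ->
  (d1 + d2)%N = d -> p * q \is d.-homog.
Proof. by move=> ph qh <-; apply: dhomogM. Qed.

Lemma dhomogX_eq d k e p : p \is d.-homog -> (d * k)%N = e ->
  p ^+ k \is e.-homog.
Proof. by move=> ph <-; apply: dhomogMn. Qed.

End HomogeneousSpan.

Section SpanModulo.
Variables (K : fieldType) (n : nat) (I : {mpoly K[n]} -> Prop) (T : finType).
Variable (e : T -> {mpoly K[n]}).
Hypothesis II : is_ideal I.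

Definition span_mod p : Prop := exists c : T -> K, I (p - \sum_i c i *: e i).

Lemma span_mod_ideal p : I p -> span_mod p.
Proof.
move=> Ip; exists (fun=> 0); rewrite big1 ?subr0 // => i _.
by rewrite scale0r.
Qed.

Lemma span_mod_gen i : span_mod (e i).
Proof.
exists (fun j => (j == i)%:R); rewrite (bigD1 i) //= eqxx scale1r big1.
  by rewrite addr0 subrr; apply: ideal0.
by move=> j /negPf->; rewrite scale0r.
Qed.

Lemma span_modD p q : span_mod p -> span_mod q -> span_mod (p + q).
Proof.
move=> [c Ic] [d Id]; exists (fun i => c i + d i).
under eq_bigr do rewrite scalerDl.
by rewrite big_split opprD addrACA; apply: idealD.
Qed.

Lemma span_modZ a p : span_mod p -> span_mod (a *: p).
Proof.
move=> [c Ic]; exists (fun i => a * c i).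
under eq_bigr do rewrite -scalerA.
by rewrite -scaler_sumr -scalerBr -mul_mpolyC; apply: idealMl.
Qed.

Lemma span_mod_sum (S : Type) (r : seq S) (P : pred S) F :
  (forall i, P i -> span_mod (F i)) -> span_mod (\sum_(i <- r | P i) F i).
Proof.
move=> SF; apply: big_ind => //; last exact: span_modD.
by apply: span_mod_ideal; apply: ideal0.
Qed.

Lemma span_mod_eq p q : I (p - q) -> span_mod q -> span_mod p.
Proof.
by move=> /span_mod_ideal Sp Sq; rewrite -(subrK q p); apply: span_modD.
Qed.

End SpanModulo.

(** * Keel's presentation in the abstract: a basis from division by a monic polynomial *)

Section Keel.
Variables (K : fieldType) (N N' : nat).
Local Notation Q := {mpoly K[N]}.
Local Notation Q' := {mpoly K[N']}.
Variables (I : Q -> Prop) (I' J : Q' -> Prop).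
Hypotheses (II : is_ideal I) (II' : is_ideal I') (IJ : is_ideal J).
Variables (pi : {rmorphism Q' -> Q}) (psi : {rmorphism Q -> {poly Q'}}).
Variables (t : Q) (hs : seq Q').

Let P : {poly Q'} := \prod_(h <- hs) ('X - h%:P).

(** For [I'] inside [J] this is the ideal generated by [I'], ['X] times [J], and [P], in a form that
    exhibits a quotient [w] by [P]. The second clause sharpens the first at the constant
    coefficient. *)
Definition keel_ideal (F : {poly Q'}) : Prop :=
  exists w, (forall i, J (F - P * w)`_i) /\ I' (F - P * w)`_0.

Hypothesis subIJ : forall p, I' p -> J p.

Lemma keel_ideal_ideal : is_ideal keel_ideal.
Proof.
split=> [|F G [v [Jv Iv]] [w [Jw Iw]]|a F [w [Jw Iw]]].
- exists 0; rewrite mulr0 subr0; split=> [i|]; rewrite coef0; exact: ideal0.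
- exists (v + w); rewrite mulrDr opprD addrACA.
  by split=> [i|]; rewrite coefD; apply: idealD.
- exists (a * w); rewrite mulrCA -mulrBr; split=> [i|].
    by rewrite coefM; apply: ideal_sum => // j _; apply: idealMl.
  by rewrite coef0M; apply: idealMl.
Qed.

Lemma keel_idealC p : I' p -> keel_ideal p%:P.
Proof.
move=> Ip; exists 0; rewrite mulr0 subr0; split=> [i|]; rewrite coefC //=.
by case: eqP => _; [apply: subIJ|apply: ideal0].
Qed.

Lemma keel_idealXC p : J p -> keel_ideal ('X * p%:P).
Proof.
move=> Jp; exists 0; rewrite mulr0 subr0; split=> [i|]; rewrite coefXM /=.
  rewrite coefC; case: eqP => _; first exact: ideal0.
  by case: eqP => _ //; apply: ideal0.
exact: ideal0.
Qed.

Lemma keel_idealP : keel_ideal P.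
Proof. by exists 1; rewrite mulr1 subrr; split=> [i|]; rewrite coef0; exact: ideal0. Qed.

(** Apart from the degree conditions and [hs_J], these say that [pi] and ['X] mapped to [t] identify
    [{poly Q'}] with [Q], with inverse [psi], and that [keel_ideal] then corresponds to [I]. *)
Hypotheses (piC : forall c, pi c%:MP = c%:MP)
  (psi_pi : forall p, psi (pi p) = p%:P) (psi_t : psi t = 'X)
  (pi_homog : forall d p, p \is d.-homog -> pi p \is d.-homog)
  (t_homog : t \is 1.-homog) (hs_homog : {in hs, forall h, h \is 1.-homog})
  (var_pi : forall i, exists u c, u \is 1.-homog /\ 'X_i = pi u + c *: t).
Hypotheses (pi_I : forall p, I' p -> I (pi p))
  (pi_J : forall p, J p -> I (t * pi p))
  (hs_I : I (\prod_(h <- hs) (t - pi h)))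
  (hs_J : forall p, J p -> I' ((\prod_(h <- hs) h) * p))
  (psi_I : forall q, I q -> keel_ideal (psi q)).
Hypothesis hs_gt0 : (0 < size hs)%N.

Let k := size hs.

Let sizeP : size P = k.+1.
Proof. by rewrite size_prod_XsubC. Qed.

Let P_lead : P`_k = 1.
Proof.
have /monicP := monic_prod_XsubC hs xpredT id.
by rewrite /lead_coef -/P sizeP.
Qed.

Let P0 : P`_0 = (-1) ^+ k * \prod_(h <- hs) h.
Proof.
rewrite -horner_coef0 horner_prod /k.
under eq_bigr do rewrite hornerXsubC sub0r.
elim: hs => [|h r IH]; first by rewrite !big_nil mul1r.
by rewrite !big_cons IH exprS mulN1r mulrCA !mulNr mulrN.
Qed.

Let P_homog s : (s <= k)%N -> P`_s \is (k - s).-homog.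
Proof.
rewrite /P /k; elim: hs hs_homog s => [|h r IH] hh s /=.
  by rewrite leqn0 => /eqP->; rewrite big_nil coef1 dhomog1.
have {}IH s' : (s' <= size r)%N ->
    (\prod_(h0 <- r) ('X - h0%:P))`_s' \is (size r - s').-homog.
  by apply: IH => x xr; apply: hh; rewrite inE xr orbT.
move=> sk; rewrite big_cons mulrBl coefB coefXM coefCM.
apply: rpredB.
  by case: s sk => [|s] sk //=; [apply: dhomog0|rewrite subSS; apply: IH].
move: sk; rewrite leq_eqVlt => /orP[/eqP->|sk].
  by rewrite [X in h * X]nth_default ?mulr0 ?dhomog0 // size_prod_XsubC.
by apply: dhomogM_eq (hh h _) (IH s _) _; rewrite ?mem_head // add1n -subSn.
Qed.

Let piZ c p : pi (c *: p) = c *: pi p.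
Proof. by rewrite -!mul_mpolyC rmorphM piC. Qed.

Lemma prod_subE : \prod_(h <- hs) (t - pi h) = \sum_(s < k.+1) pi P`_s * t ^+ s.
Proof.
have -> : \prod_(h <- hs) (t - pi h) = (map_poly pi P).[t].
  rewrite rmorph_prod horner_prod; apply: eq_bigr => h _.
  by rewrite /= rmorphB /= map_polyX map_polyC /= hornerXsubC.
rewrite (@horner_coef_wide _ k.+1); last by rewrite -sizeP size_poly.
by apply: eq_bigr => s _; rewrite coef_map.
Qed.

Let coefJ F w : (forall i, J (F - P * w)`_i) ->
  (forall i, (k <= i)%N -> F`_i = 0) -> forall j, J w`_j.
Proof.
move=> JD F0 j; have [m] := ubnP (size w - j).
elim: m j => // m IH j; rewrite ltnS => jm.
have [wj|jw] := leqP (size w) j; first by rewrite nth_default //; apply: ideal0.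
have Jw i : (j < i)%N -> J w`_i.
  by move=> ji; apply: IH; apply: leq_trans jm; apply: ltn_sub2l.
have := JD (k + j)%N; rewrite coefB F0 ?leq_addr // sub0r => /(idealN IJ).
rewrite opprK coefM.
have kj : (k < (k + j).+1)%N by rewrite ltnS leq_addr.
rewrite (bigD1 (Ordinal kj)) //= P_lead mul1r addKn => Jsum.
rewrite -[w`_j](addrK (\sum_(i < (k + j).+1 | i != Ordinal kj) P`_i * w`_(k + j - i))).
apply: idealB => //; apply: ideal_sum => // i /negP ik.
have [ki|] := ltnP k i.
  by rewrite [P`_i]nth_default ?sizeP // mul0r; apply: ideal0.
rewrite leq_eqVlt => /orP[/eqP ik'|ik']; first by case: ik; apply/eqP/val_inj.
by apply: idealMl => //; apply: Jw; rewrite ltn_subRL ltn_add2r.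
Qed.

Section Bases.
Variables (d a : nat) (b : nat -> nat).
(** Truncated subtraction would turn [d - r.+1] into degree 0 for [r >= d]; the value 0 makes the
    index set empty there. *)
Let bb (r : nat) := (if r < d then b (d - r.+1) else 0)%N.
Variables (ea : 'I_a -> Q') (eb : forall r, 'I_(bb r) -> Q').
Hypothesis (ha : hbasis I' d ea).
Hypothesis (hb : forall r, (r < d)%N -> hbasis J (d - r.+1) (@eb r)).

Let T : finType := ('I_a + {r : 'I_k.-1 & 'I_(bb r)})%type.

Let el (x : T) : Q := match x with
  | inl i => pi (ea i)
  | inr y => t ^+ (tag y).+1 * pi (@eb (tag y) (tagged y))
  end.

Let bb_lt (r : nat) (j : 'I_(bb r)) : (r < d)%N.
Proof. by move: j; rewrite /bb; case: ltnP => // _ []. Qed.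

Let sumT (c : T -> K) : \sum_x c x *: el x =
  pi (\sum_i c (inl i) *: ea i) +
  \sum_(r < k.-1) t ^+ r.+1 *
     pi (\sum_(j : 'I_(bb r)) c (inr (Tagged (fun r : 'I_k.-1 => 'I_(bb r)) j)) *: @eb r j).
Proof.
rewrite big_sumType /=; congr (_ + _).
  by rewrite rmorph_sum; apply: eq_bigr => i _; rewrite piZ.
pose F (r : 'I_k.-1) (j : 'I_(bb r)) :=
   c (inr (Tagged (fun r : 'I_k.-1 => 'I_(bb r)) j)) *: (t ^+ r.+1 * pi (@eb r j)).
transitivity (\sum_(r < k.-1) \sum_j F r j).
  rewrite sig_big_dep /=; apply: eq_bigr => -[r j] _ //=.
apply: eq_bigr => r _; rewrite rmorph_sum mulr_sumr.
by apply: eq_bigr => j _; rewrite /F piZ scalerAr.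
Qed.

(** The image under [psi] has degree below [k], so by [coefJ] the quotient [w] has coefficients in
    [J], and so has the image. Its constant coefficient is even in [I']: the constant term of [P] is
    up to sign the product over [hs], which sends [J] into [I']. *)
Lemma keel_free (c : T -> K) : I (\sum_x c x *: el x) -> forall x, c x = 0.
Proof.
rewrite sumT; set A0 := \sum_i c (inl i) *: ea i.
pose B0 (r : 'I_k.-1) := \sum_(j : 'I_(bb r)) c (inr (Tagged (fun r : 'I_k.-1 => 'I_(bb r)) j)) *: @eb r j.
move=> /psi_I; set q := _ + _.
have -> : psi q = A0%:P + \sum_(r < k.-1) 'X^(r.+1) * (B0 r)%:P.
  rewrite rmorphD psi_pi; congr (_ + _); rewrite rmorph_sum.
  by apply: eq_bigr => r _; rewrite /= rmorphM /= rmorphXn /= psi_t psi_pi.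
set F := _ + _; move=> [w [JD ID]].
have FE i : F`_i = (if i == 0%N then A0 else 0) +
    \sum_(r < k.-1) (if i == r.+1 then B0 r else 0).
  rewrite coefD coefC coef_sum; congr (_ + _); apply: eq_bigr => r _.
  rewrite coefXnM coefC subn_eq0; case: ltngtP => //.
have F_ge i : (k <= i)%N -> F`_i = 0.
  move=> ki; rewrite FE gtn_eqF ?(leq_trans hs_gt0) // big1 ?addr0 // => r _.
  rewrite gtn_eqF // (leq_ltn_trans (ltn_ord r)) // (leq_trans _ ki) //.
  by rewrite prednK.
have Jw := coefJ JD F_ge.
have JF i : J F`_i.
  apply: (ideal_eq IJ (b := (P * w)`_i)); first by rewrite -coefB.
  by rewrite coefM; apply: ideal_sum => // j _; apply: idealMl.
have c1 i : c (inl i) = 0.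
  have [_ ef _] := ha; apply: (ef (c \o inl)); rewrite -/A0.
  have <- : F`_0 = A0 by rewrite FE eqxx big1 ?addr0.
  apply: (ideal_eq II' (b := (P * w)`_0)); first by rewrite -coefB.
  by rewrite coef0M P0 -mulrA; apply: idealMl => //; apply: hs_J.
case=> [i|[r j]]; first exact: c1.
have [_ ef _] := hb (bb_lt j).
apply: (ef (fun j => c (inr (Tagged (fun r : 'I_k.-1 => 'I_(bb r)) j)))).
rewrite -/(B0 r) (_ : B0 r = F`_r.+1) // FE /= add0r (bigD1 r) //= eqxx.
rewrite big1 ?addr0 // => r' /negPf; rewrite eqSS -val_eqE /= eq_sym => ->.
by [].
Qed.

Let Sp := span_mod I el.

(** Powers of [t] from the [k]-th on are lowered by the monic relation [hs_I], at the cost of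
    coefficients of [P]. Below that, [p] is reduced modulo [I'] if [r = 0] and modulo [J]
    otherwise. *)
Let span_tpi r p e : p \is e.-homog -> (r + e)%N = d -> Sp (t ^+ r * pi p).
Proof.
have [m] := ubnP r; elim: m r p e => // m IH r p e; rewrite ltnS => rm ph rd.
have [kr|rk] := leqP k r.
  apply: (span_mod_eq II (q := t ^+ r * pi p - (t ^+ (r - k) * pi p) *
     \prod_(h <- hs) (t - pi h))).
    by rewrite opprB addrC subrK; apply: idealMl.
  have -> : t ^+ r * pi p - (t ^+ (r - k) * pi p) * \prod_(h <- hs) (t - pi h)
      = \sum_(s < k) (-1) *: (t ^+ (r - k + s) * pi (P`_s * p)).
    rewrite prod_subE big_ord_recr /= P_lead rmorph1 mul1r mulrDr opprD.
    rewrite [_ * pi p * t ^+ k]mulrAC -exprD subnK // addrCA subrr addr0.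
    rewrite mulr_sumr -sumrN; apply: eq_bigr => s _.
    rewrite scaleN1r exprD rmorphM /= [pi P`_s * t ^+ s]mulrC mulrACA.
    by rewrite [pi p * _]mulrC.
  apply: span_mod_sum => // s _; apply: span_modZ => //.
  apply: (IH _ _ (k - s + e)%N).
  - by apply: leq_trans rm; rewrite -ltn_subRL subKn.
  - by apply: dhomogM => //; apply: P_homog; apply: ltnW.
  - rewrite addnA -[(_ + _ + (_ - _))%N]addnA subnKC 1?ltnW //.
    by rewrite subnK.
case: r rk rd {rm IH} => [|r] rk rd.
  have [_ _ es] := ha; rewrite add0n in rd; rewrite rd in ph.
  have [c Ic] := es _ ph; rewrite mul1r.
  apply: (span_mod_eq II (q := \sum_i c i *: el (inl i))); last first.
    by apply: span_mod_sum => // i _; apply: span_modZ => //; apply: span_mod_gen.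
  have -> : \sum_i c i *: el (inl i) = pi (\sum_i c i *: ea i).
    by rewrite rmorph_sum; apply: eq_bigr => i _; rewrite piZ.
  by rewrite -rmorphB; apply: pi_I.
have rd' : (r < d)%N by rewrite -rd leq_addr.
have rk' : (r < k.-1)%N by rewrite -ltnS prednK.
have [_ _ es] := hb rd'.
have [|c Jc] := es p; first by rewrite -rd addKn.
pose g j : T := inr (Tagged (fun r : 'I_k.-1 => 'I_(bb r)) (j : 'I_(bb (Ordinal rk')))).
apply: (span_mod_eq II (q := \sum_j c j *: el (g j))); last first.
  by apply: span_mod_sum => // i _; apply: span_modZ => //; apply: span_mod_gen.
have -> : \sum_j c j *: el (g j) = t ^+ r.+1 * pi (\sum_j c j *: eb j).
  rewrite rmorph_sum mulr_sumr; apply: eq_bigr => j _.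
  by rewrite piZ -scalerAr.
rewrite -mulrBr -rmorphB exprSr -mulrA; apply: idealMl => //.
exact: pi_J.
Qed.

Lemma keel_basis : hbasis I d el.
Proof.
split; first 2 last.
- apply: homog_ind => [||c p|s sd].
  + exact: span_mod_ideal (ideal0 II).
  + exact: span_modD.
  + exact: span_modZ.
  suff key r e p : p \is e.-homog -> (r + e + size s)%N = d ->
      Sp (t ^+ r * pi p * \prod_(i <- s) 'X_i).
    have := key 0%N 0%N 1 (dhomog1 _ _) sd.
    by rewrite expr0 rmorph1 !mul1r.
  elim: s {sd} r e p => [|i s IH] r e p ph rd.
    by rewrite big_nil mulr1; apply: span_tpi ph _; rewrite -rd addn0.
  rewrite big_cons; have [u [c [uh ->]]] := var_pi i.
  rewrite mulrDl mulrDr; apply: span_modD => //.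
    rewrite -/Sp mulrA -(mulrA _ _ (pi u)) -rmorphM.
    apply: (IH _ (e + 1)%N); first exact: dhomogM.
    by rewrite -rd /= addnA addn1 addnS addSn.
  rewrite -scalerAl -scalerAr; apply: span_modZ => //.
  rewrite mulrCA mulrA mulrA -exprS.
  by apply: IH ph _; rewrite -rd /= addnS !addSn.
- case=> [i|[r j]] /=; first by apply: pi_homog; have [+ _ _] := ha; apply.
  apply: (dhomogM_eq (d1 := r.+1) (d2 := (d - r.+1)%N)).
  + by apply: dhomogX_eq t_homog _; rewrite mul1n.
  + by apply: pi_homog; have [+ _ _] := hb (bb_lt j); apply.
  + by rewrite subnKC // bb_lt.
- exact: keel_free.
Qed.

End Bases.

Lemma keel_hdim d a b : hdim I' d a -> (forall m, hdim J m (b m)) ->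
  hdim I d (a + \sum_(1 <= i < k) (if i <= d then b (d - i) else 0))%N.
Proof.
move=> [ea ha] Hb.
have Hb' r : exists e : 'I_(if r < d then b (d - r.+1) else 0)%N -> Q',
    (r < d)%N -> hbasis J (d - r.+1) e.
  case: ltnP => rd; last by exists (fun=> 0).
  by have [e he] := Hb (d - r.+1)%N; exists e.
have := hbasis_hdim (keel_basis ha (fun r => svalP (cid (Hb' r)))).
rewrite card_sum card_ord card_tagged sumnE big_map big_enum /=.
rewrite big_add1 big_mkord (_ : (\sum_(i < k.-1) _)%N =
  (\sum_(i < k.-1) (if i < d then b (d - i.+1) else 0))%N) //.
by apply: eq_bigr => i _; rewrite card_ord.
Qed.

End Keel.

(** * Linear forms vanishing on a homogeneous ideal *)

Section Functionals.
Variables (K : fieldType) (n : nat).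
Local Notation Q := {mpoly K[n]}.
Variable I : Q -> Prop.
Hypothesis II : is_ideal I.

Definition homog_closed : Prop := forall d p, I p -> I (pihomog mdeg d p).

Definition killing_form (lam : Q -> K) : Prop :=
  (forall c p, lam (c *: p) = c * lam p) /\ (forall p, I p -> lam p = 0).

(** The form is a coordinate after projection to degree [d]. Homogeneity of [I] makes the projection
    preserve [I], so that the form vanishes on all of [I]. *)
Lemma coord_form d (T : finType) (e : T -> Q) x : homog_closed ->
  hbasis I d e -> exists lam : {additive Q -> K},
  [/\ killing_form lam, forall y, lam (e y) = (y == x)%:R
    & forall d' p, d' != d -> p \is d'.-homog -> lam p = 0].
Proof.
move=> hI [eh ef es].
have [c cE] := choice (fun p => es _ (pihomogP mdeg d p)).
have c_uniq p a : I (pihomog mdeg d p - \sum_i a i *: e i) -> c p =1 a.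
  move=> Ia i; apply/eqP; rewrite -subr_eq0; apply/eqP.
  apply: (ef (fun i => c p i - a i)); under eq_bigr do rewrite scalerBl.
  rewrite sumrB; have := idealB II Ia (cE p).
  by rewrite opprB addrC addrA subrK.
have cB : zmod_morphism (fun p => c p x).
  move=> p q; apply: (c_uniq _ (fun i => c p i - c q i)).
  under eq_bigr do rewrite scalerBl.
  rewrite sumrB linearB /=; have := idealB II (cE p) (cE q).
  by rewrite !opprB addrACA [- (\sum_i _) - _]addrC addrACA.
pose lam : {additive Q -> K} := HB.pack_for {additive Q -> K} (fun p => c p x)
  (GRing.isZmodMorphism.Build Q K (fun p => c p x) cB).
exists lam; split=> [|y|d' p dd ph] /=; first split=> [a p|p Ip] /=.
- apply: (c_uniq _ (fun i => a * c p i)).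
  under eq_bigr do rewrite -scalerA.
  rewrite -scaler_sumr linearZ /= -scalerBr -mul_mpolyC.
  exact: idealMl.
- apply: (c_uniq _ (fun=> 0)); rewrite big1 => [|i _]; last by rewrite scale0r.
  by rewrite subr0; apply: hI.
- rewrite eq_sym; apply: (c_uniq _ (fun i => (i == y)%:R)).
  rewrite (bigD1 y) //= eqxx scale1r big1 => [|i /negPf->]; last first.
    by rewrite scale0r.
  by rewrite addr0 pihomog_dE // subrr; apply: ideal0.
- apply: (c_uniq _ (fun=> 0)); rewrite big1 => [|i _]; last by rewrite scale0r.
  by rewrite subr0 (pihomog_ne0 dd ph); apply: ideal0.
Qed.

End Functionals.

Lemma ideal_gen_homog_closed (K : fieldType) n (J : finType)
    (g : J -> {mpoly K[n]}) : (forall j, exists d, g j \is d.-homog) ->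
  homog_closed (fun p => p \in ideal_gen g).
Proof.
move=> gh d p /ideal_genP[c ->]; rewrite linear_sum.
apply: rpred_sum => j _; have [e ge] := gh j.
rewrite [c j]mpolyE mulr_suml linear_sum; apply: rpred_sum => m _ /=.
rewrite -scalerAl linearZ /= -mul_mpolyC; apply: ideal_genMl.
have mgh : 'X_[m] * g j \is (mdeg m + e).-homog.
  by apply: dhomogM => //; rewrite dhomogX.
have [de|de] := eqVneq (mdeg m + e)%N d.
  by rewrite pihomog_dE -?de // ideal_genMl // ideal_gen_mem.
by rewrite (pihomog_ne0 de mgh) rpred0.
Qed.

(** * Graded pieces of a tensor product of two quotients *)

Section Tensor.
Variables (K : fieldType) (n1 n2 n : nat).
Local Notation Q1 := {mpoly K[n1]}.
Local Notation Q2 := {mpoly K[n2]}.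
Local Notation Q := {mpoly K[n]}.
Local Notation Q12 := {mpoly Q1[n2]}.
Variables (I1 : Q1 -> Prop) (I2 : Q2 -> Prop) (J : Q -> Prop).
Hypotheses (II1 : is_ideal I1) (II2 : is_ideal I2) (IJ : is_ideal J).

(* A model of the ideal generated by I1 and I2 in the tensor product Q12 of Q1
   and Q2 which does not require choosing a complement of I1. *)
Definition tensor_ideal (u : Q12) : Prop :=
  forall lam : {additive Q1 -> K}, killing_form I1 lam -> I2 (map_mpoly lam u).

Lemma map_mpolyZX (lam : {additive Q1 -> K}) c (m : 'X_{1..n2}) :
  map_mpoly lam (c *: 'X_[m]) = lam c *: 'X_[m].
Proof.
apply/mpolyP => k; rewrite mcoeff_map_mpoly !mcoeffZ !mcoeffX.
by case: eqP => _; rewrite ?mulr1 ?mulr0 ?raddf0.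
Qed.

Lemma tensor_ideal_ideal : is_ideal tensor_ideal.
Proof.
split=> [lam _|u v Iu Iv lam lk|a u Iu lam lk].
- by rewrite raddf0; apply: ideal0.
- by rewrite raddfD; apply: idealD => //; [apply: Iu|apply: Iv].
rewrite [a]mpolyE mulr_suml raddf_sum; apply: ideal_sum => // m _ /=.
(* Preceding [lam] by multiplication with a coefficient of [a] gives another form that kills [I1],
   because [I1] is an ideal. *)
have lamB : zmod_morphism (fun p => lam (a@_m * p)).
  by move=> p q; rewrite mulrBr raddfB.
pose lam' : {additive Q1 -> K} := HB.pack_for {additive Q1 -> K}
  (fun p => lam (a@_m * p)) (GRing.isZmodMorphism.Build Q1 K _ lamB).
have -> : map_mpoly lam (a@_m *: 'X_[m] * u) = 'X_[m] * map_mpoly lam' u.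
  rewrite [X in map_mpoly lam (_ * X)](mpolyE u).
  rewrite [X in map_mpoly lam' X](mpolyE u).
  rewrite mulr_sumr !raddf_sum mulr_sumr.
  apply: eq_bigr => k _ /=.
  rewrite -scalerAl -scalerAr scalerA -mpolyXD map_mpolyZX.
  by rewrite (map_mpolyZX lam') -scalerAr -mpolyXD.
apply: idealMl => //; apply: Iu; split=> [c p|p Ip] /=.
  by rewrite -scalerAr lk.1.
by rewrite lk.2 //; apply: idealMl.
Qed.

Definition tensor_inr : Q2 -> Q12 := map_mpoly (@mpolyC n1 K).
HB.instance Definition _ := GRing.RMorphism.on tensor_inr.

Lemma map_mpoly_tensor (lam : {additive Q1 -> K}) p q : killing_form I1 lam ->
  map_mpoly lam (p%:MP * tensor_inr q) = lam p *: q.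
Proof.
move=> lk; apply/mpolyP => m; rewrite mcoeff_map_mpoly mcoeffCM.
rewrite mcoeff_map_mpoly mcoeffZ mulrC mul_mpolyC lk.1 mulrC //.
Qed.

Lemma tensor_ideal1 p : I1 p -> tensor_ideal p%:MP.
Proof. by move=> Ip lam lk; rewrite map_mpolyC lk.2 // mpolyC0; apply: ideal0. Qed.

Lemma tensor_ideal2 q : I2 q -> tensor_ideal (tensor_inr q).
Proof.
move=> Iq lam lk; rewrite -[tensor_inr q]mul1r -mpolyC1 map_mpoly_tensor //.
by rewrite -mul_mpolyC; apply: idealMl.
Qed.

Variables (sig : {rmorphism Q1 -> Q}) (tau : {rmorphism Q2 -> Q}).
Variable (rho : {rmorphism Q -> Q12}).
Hypotheses (sigC : forall c, sig c%:MP = c%:MP)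
  (tauC : forall c, tau c%:MP = c%:MP) (rhoC : forall c, rho c%:MP = c%:MP%:MP).
Hypotheses (sig_homog : forall d p, p \is d.-homog -> sig p \is d.-homog)
  (tau_homog : forall d p, p \is d.-homog -> tau p \is d.-homog).
Hypotheses (sig_I : forall p, I1 p -> J (sig p))
  (tau_I : forall p, I2 p -> J (tau p))
  (rho_J : forall p, J p -> tensor_ideal (rho p))
  (rho_sig : forall p, rho (sig p) = p%:MP)
  (rho_tau : forall p, rho (tau p) = tensor_inr p)
  (homI1 : homog_closed I1)
  (var_sig_tau : forall i, exists u v,
     [/\ u \is 1.-homog, v \is 1.-homog & J ('X_i - (sig u + tau v))]).

Section Bases.
Variables (d : nat) (a b : nat -> nat).
Variables (ea : forall m, 'I_(a m) -> Q1) (eb : forall m, 'I_(b m) -> Q2).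
Hypotheses (ha : forall m, hbasis I1 m (@ea m)) (hb : forall m, hbasis I2 m (@eb m)).

Let T_ (i : 'I_d.+1) : finType := ('I_(a i) * 'I_(b (d - i)))%type.
Let T : finType := {i : 'I_d.+1 & T_ i}.

Let el (x : T) : Q := sig (ea (tagged x).1) * tau (eb (tagged x).2).

(** The coordinate form of [ea x], applied to coefficients, isolates the terms whose first component
    is [x] in degree [i]; what is left is a relation among the [eb y] modulo [I2]. *)
Lemma tensor_free (c : T -> K) : J (\sum_x c x *: el x) -> forall x, c x = 0.
Proof.
move=> /rho_J Jc [i [x y]].
have [lam [lk lx l0]] := coord_form II1 x homI1 (ha i).
have := Jc _ lk; rewrite !raddf_sum /=.
have -> : \sum_z map_mpoly lam (rho (c z *: el z)) =
    \sum_y c (Tagged T_ (x, y)) *: eb y.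
  transitivity (\sum_(i' < d.+1) \sum_(z : T_ i')
      (c (Tagged T_ z) * lam (ea z.1)) *: eb z.2).
    rewrite sig_big_dep /=; apply: eq_bigr => -[i' z] _ /=.
    rewrite -mul_mpolyC !rmorphM /= rhoC rho_sig rho_tau /= mulrA -mpolyCM.
    by rewrite map_mpoly_tensor // mul_mpolyC lk.1.
  rewrite (bigD1 i) //= [X in _ + X]big1 ?addr0 => [|i' ii']; last first.
    rewrite big1 // => z _; have [eh _ _] := ha i'.
    by rewrite (l0 _ _ _ (eh z.1)) ?mulr0 ?scale0r //.
  transitivity (\sum_(x' : 'I_(a i)) \sum_(y' : 'I_(b (d - i)))
      (c (Tagged T_ ((x', y') : T_ i)) * lam (ea x')) *: eb y').
    by rewrite pair_big; apply: eq_bigr => -[].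
  rewrite (bigD1 x) //= [X in _ + X]big1 ?addr0 => [|x' xx'].
    by apply: eq_bigr => y' _; rewrite lx eqxx mulr1.
  by rewrite big1 // => y' _; rewrite lx (negPf xx') mulr0 scale0r.
have [_ ef _] := hb (d - i) => Ic.
exact: (ef (fun y => c (Tagged T_ ((x, y) : T_ i))) Ic y).
Qed.

Let Sp := span_mod J el.

Let sigZ c p : sig (c *: p) = c *: sig p.
Proof. by rewrite -!mul_mpolyC rmorphM sigC. Qed.
Let tauZ c p : tau (c *: p) = c *: tau p.
Proof. by rewrite -!mul_mpolyC rmorphM tauC. Qed.

Let span_sig_tau i j p q : p \is i.-homog -> q \is j.-homog -> (i + j)%N = d ->
  Sp (sig p * tau q).
Proof.
move=> ph qh ijd; have id : (i < d.+1)%N by rewrite ltnS -ijd leq_addr.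
rewrite -(_ : d - Ordinal id = j)%N in qh; last by rewrite /= -ijd addKn.
have [_ _ /(_ _ ph) [f Ipf]] := ha (Ordinal id).
have [_ _ /(_ _ qh) [g Ipg]] := hb (d - Ordinal id).
set p' := \sum_i _ in Ipf; set q' := \sum_i _ in Ipg.
apply: (span_mod_eq IJ (q := sig p' * tau q')).
  have -> : sig p * tau q - sig p' * tau q' =
      sig (p - p') * tau q + sig p' * tau (q - q').
    by rewrite !rmorphB mulrBl mulrBr addrA subrK.
  by apply: idealD => //; [apply: idealMr|apply: idealMl] => //;
    [apply: sig_I|apply: tau_I].
rewrite rmorph_sum rmorph_sum mulr_suml; apply: span_mod_sum => // x _.
rewrite mulr_sumr; apply: span_mod_sum => // y _ /=.
rewrite sigZ tauZ -scalerAl -scalerAr; do 2![apply: span_modZ => //].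
exact: (span_mod_gen el IJ (Tagged T_ (x, y))).
Qed.

Lemma tensor_basis : hbasis J d el.
Proof.
split=> [[i [x y]]|c|]; first 1 last.
- exact: tensor_free.
- apply: homog_ind => [||c p|s sd].
  + exact: span_mod_ideal (ideal0 IJ).
  + exact: span_modD.
  + exact: span_modZ.
  suff key i j p q : p \is i.-homog -> q \is j.-homog ->
      (i + j + size s)%N = d -> Sp (sig p * tau q * \prod_(i <- s) 'X_i).
    have := key 0%N 0%N 1 1 (dhomog1 _ _) (dhomog1 _ _) sd.
    by rewrite !rmorph1 !mul1r.
  elim: s {sd} i j p q => [|z s IH] i j p q ph qh ijd.
    by rewrite big_nil mulr1; apply: span_sig_tau ph qh _; rewrite -ijd addn0.
  have [u [v [uh vh Juv]]] := var_sig_tau z.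
  rewrite big_cons.
  apply: (span_mod_eq IJ (q := sig p * tau q *
     ((sig u + tau v) * \prod_(i <- s) 'X_i))).
    by rewrite -mulrBr -mulrBl mulrCA; apply: idealMr.
  rewrite mulrA mulrDr mulrDl; apply: span_modD => //.
    rewrite [sig p * tau q * sig u]mulrAC -rmorphM.
    apply: (IH (i + 1)%N j) => //; first exact: dhomogM.
    by rewrite -ijd /= addn1 addnS !addSn.
  rewrite -[sig p * tau q * tau v]mulrA -rmorphM.
  apply: (IH i (j + 1)%N) => //; first exact: dhomogM.
  by rewrite -ijd /= addn1 !addnS !addSn.
- apply: (dhomogM_eq (d1 := i) (d2 := (d - i)%N)) => /=.
  + by apply: sig_homog; have [+ _ _] := ha i; apply.
  + by apply: tau_homog; have [+ _ _] := hb (d - i); apply.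
  + by rewrite subnKC // -ltnS.
Qed.

End Bases.

Lemma tensor_hdim d a b : (forall m, hdim I1 m (a m)) ->
  (forall m, hdim I2 m (b m)) -> hdim J d (\sum_(i < d.+1) a i * b (d - i))%N.
Proof.
move=> Ha Hb.
have := hbasis_hdim (tensor_basis d (fun m => svalP (cid (Ha m)))
  (fun m => svalP (cid (Hb m)))).
rewrite card_tagged sumnE big_map big_enum /=.
rewrite (_ : (\sum_(i < d.+1) _)%N = (\sum_(i < d.+1) a i * b (d - i))%N) //.
by apply: eq_bigr => i _; rewrite card_prod !card_ord.
Qed.

End Tensor.

Local Open Scope nat_scope.

(** * Closure and rank *)

Section MatroidFlats.
Variables (E : finType) (M : matroid E).
Implicit Types (A B F S : {set E}).

Lemma flatP F : reflect (forall e, e \notin F -> rk M F < rk M (e |: F)) (flat M F).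
Proof. by apply: (iffP forallP) => H e; [apply/implyP|apply/implyP; apply: H]. Qed.

Lemma sub_cl A : A \subset cl M A.
Proof. by apply/bigcapsP => F /andP[]. Qed.

Lemma cl_sub A F : flat M F -> A \subset F -> cl M A \subset F.
Proof. by move=> fF AF; apply: bigcap_inf; rewrite inE fF. Qed.

(** A point outside the closure is missed by some flat above [A]; submodularity carries its rank
    jump from that flat down to the closure. *)
Lemma flat_cl A : flat M (cl M A).
Proof.
apply/flatP => e eA; rewrite ltnNge; apply/negP => le_e.
have [F /andP[]] : exists2 F, (F \in flats M) && (A \subset F) & e \notin F.
  apply/exists_inP; apply: contraNT eA; rewrite negb_exists_in => /forall_inP H.
  by apply/bigcapP => F FA; have := H F FA; rewrite negbK.
rewrite inE => fF AF eF; have clF := cl_sub fF AF.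
have := flatP _ fF _ eF; apply/negP; rewrite -leqNgt.
have := rk_submod M F (e |: cl M A).
rewrite setUCA (setUidPl clF) => le1.
rewrite -(leq_add2r (rk M (cl M A))).
apply: leq_trans (leq_trans le1 _); last by rewrite leq_add2l.
by rewrite leq_add2l; apply: rk_mono; rewrite subsetI clF subsetUr.
Qed.

(** A largest set containing [A] with the same rank is a flat, hence contains the closure. *)
Lemma rk_cl A : rk M (cl M A) = rk M A.
Proof.
apply/eqP; rewrite eqn_leq [rk M A <= _]rk_mono ?sub_cl // andbT.
have PA : (A \subset A) && (rk M A == rk M A) by rewrite subxx eqxx.
case: (@arg_maxnP _ A (fun F => (A \subset F) && (rk M F == rk M A))
   (fun F => #|F|) PA) => F /andP[AF /eqP rF] maxF.
rewrite -rF; apply/rk_mono/cl_sub => //; apply/flatP => e eF.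
rewrite ltnNge; apply/negP => le_e.
have /maxF : (A \subset e |: F) && (rk M (e |: F) == rk M A).
  rewrite (subset_trans AF) ?subsetUr //= -rF eqn_leq le_e /=.
  by apply: rk_mono; apply: subsetUr.
by rewrite /= cardsU1 eF add1n ltnn.
Qed.

Lemma cl_id F : flat M F -> cl M F = F.
Proof. by move=> fF; apply/eqP; rewrite eqEsubset sub_cl cl_sub. Qed.

Lemma flatI F F' : flat M F -> flat M F' -> flat M (F :&: F').
Proof.
move=> fF fF'; rewrite (_ : F :&: F' = cl M (F :&: F')) ?flat_cl //.
by apply/eqP; rewrite eqEsubset sub_cl subsetI !cl_sub ?subsetIl ?subsetIr.
Qed.

Lemma flat_rk_eq F F' : flat M F -> F \subset F' -> rk M F' <= rk M F -> F = F'.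
Proof.
move=> /flatP fF FF' le; apply/eqP; rewrite eqEsubset FF'.
apply/subsetP => e eF'; apply: contraLR le => eF; rewrite -ltnNge.
by apply: leq_trans (fF _ eF) _; apply: rk_mono; rewrite subUset sub1set eF'.
Qed.

(** Diminishing returns: this is how exponents computed in [M/G] compare with those computed in
    [M]. *)
Lemma rk_sub_setU A B G : A \subset B ->
  rk M (B :|: G) - rk M (A :|: G) <= rk M B - rk M A.
Proof.
move=> AB; rewrite leq_subLR addnBA ?rk_mono // leq_subRL; last first.
  by rewrite (leq_trans (rk_mono M AB)) // leq_addl.
rewrite addnC [X in _ <= X]addnC; apply: leq_trans (rk_submod M _ _).
by rewrite setUA (setUidPl AB) leq_add2l rk_mono // subsetI AB subsetUl.
Qed.

Lemma rk_setU A B : rk M (A :|: B) <= rk M A + rk M B.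
Proof. exact: leq_trans (leq_addr _ _) (rk_submod M _ _). Qed.

Lemma rk_bigcup (T : finType) (P : pred T) (F : T -> {set E}) :
  rk M (\bigcup_(i | P i) F i) <= \sum_(i | P i) rk M (F i).
Proof.
elim/big_rec2: _ => [|i y A _ IH]; first by rewrite rk_set0.
by apply: leq_trans (rk_setU _ _) _; rewrite leq_add2l.
Qed.

Hypothesis loopM : loopless M.

Lemma rk_gt0 A x : x \in A -> 0 < rk M A.
Proof.
move=> xA; have /flatP/(_ x) := loopM; rewrite inE rk_set0 => /(_ isT) H.
by apply: leq_trans H _; apply: rk_mono; rewrite setU0 sub1set.
Qed.

Lemma cl0 : cl M set0 = set0.
Proof. exact: cl_id. Qed.

End MatroidFlats.

(** * Factors of a flat with respect to a building set *)

Section MaximalElements.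
Variables (E : finType) (Bs : {set {set E}}) (F : {set E}).

Lemma maxel_belowP H : H \in maxel (below Bs F) ->
  [/\ H \in Bs, H \subset F
    & forall K, K \in Bs -> K \subset F -> H \subset K -> H = K].
Proof.
rewrite inE => /andP[]; rewrite inE => /andP[HB HF] /forall_inP maxH; split=> //.
move=> K KB KF HK; apply/eqP; rewrite eqEproper HK.
by apply: maxH; rewrite inE KB.
Qed.

Lemma maxel_above B : B \in Bs -> B \subset F ->
  exists2 H, H \in maxel (below Bs F) & B \subset H.
Proof.
move=> BB BF; have P0 : [&& B \in Bs, B \subset F & B \subset B].
  by rewrite BB BF subxx.
case: (@arg_maxnP _ B (fun H => [&& H \in Bs, H \subset F & B \subset H])
   (fun H => #|H|) P0) => H /and3P[HB HF BH] maxH.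
exists H => //; rewrite inE inE HB HF /=; apply/forall_inP => K.
rewrite inE => /andP[KB KF]; apply/negP => HK.
have := proper_card HK; apply/negP; rewrite -leqNgt; apply: maxH.
by rewrite KB KF (subset_trans BH) // proper_sub.
Qed.

End MaximalElements.

Section BuildingSets.
Variables (E : finType) (M : matroid E) (Bs : {set {set E}}).
Hypotheses (loopM : loopless M) (bB : building_set M Bs).
Implicit Types (F G H K : {set E}).

Lemma bs_flat H : H \in Bs -> flat M H.
Proof. by case: bB => /subsetP BF _ /BF; rewrite !inE => /andP[]. Qed.

Lemma bs_neq0 H : H \in Bs -> H != set0.
Proof. by case: bB => /subsetP BF _ /BF; rewrite !inE => /andP[]. Qed.

Lemma bs_rk F : flat M F -> rk M F = \sum_(H in maxel (below Bs F)) rk M H.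
Proof. by case: bB => _ H fF; have [|] := H F; rewrite ?inE. Qed.

(** Injectivity of the join map: putting [H :&: H'] in the coordinate [H] or in the coordinate [H']
    gives the same join, so for distinct factors the intersection is empty. *)
Lemma bs_disj F H H' x : flat M F -> H \in maxel (below Bs F) ->
  H' \in maxel (below Bs F) -> x \in H -> x \in H' -> H = H'.
Proof.
move=> fF mH mH' xH xH'; case: bB => _ /(_ F) [|[inj _ _ _] _]; first by rewrite inE.
set D := maxel _ in mH mH' inj.
have fH K : K \in D -> flat M K by move=> /maxel_belowP[/bs_flat].
pose phi L := [ffun K : {set E} => if K == L then H :&: H' else set0].
have phi_in L : L \in D -> H :&: H' \subset L -> phi L \in lower_prod M D.
  move=> LD sL; apply/pfamilyP; split=> [|K KD].
    by apply/supportP => K; rewrite ffunE; case: eqP => // ->; rewrite LD.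
  rewrite ffunE inE; case: eqP => [->|_]; rewrite !inE.
    by rewrite sL flatI ?fH.
  by rewrite sub0set andbT; exact: loopM.
have joinE L : L \in D -> join_map M D (phi L) = cl M (H :&: H').
  move=> LD; congr (cl M _); rewrite (bigD1 L) //= ffunE eqxx big1 ?setU0 //.
  by move=> K /andP[_ /negPf KL]; rewrite ffunE KL.
have := inj _ _ (phi_in H mH (subsetIl _ _)) (phi_in H' mH' (subsetIr _ _)).
rewrite !joinE // => /(_ erefl) /ffunP /(_ H); rewrite !ffunE eqxx.
by case: eqP => // _ /setP /(_ x); rewrite !inE xH xH'.
Qed.

(** Surjectivity of the join map: the closure of [x] has rank at most 1, so a nonempty component of
    its preimage is the whole closure. *)
Lemma bs_cover F x : flat M F -> x \in F ->
  exists2 H, H \in maxel (below Bs F) & x \in H.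
Proof.
move=> fF xF; case: bB => _ /(_ F) [|[_ surj _ _] _]; first by rewrite inE.
set D := maxel _ in surj *.
have : cl M [set x] \in lower M F.
  by rewrite !inE flat_cl cl_sub ?sub1set.
rewrite -surj => /imsetP[phi /pfamilyP[_ phiD] clx].
have [H HD pH] : exists2 H, H \in D & phi H != set0.
  apply/exists_inP; rewrite -[X in is_true X]negbK negb_exists_in.
  apply/negP => /forall_inP H0.
  have /setP/(_ x) := clx; rewrite (subsetP (sub_cl M _)) ?set11 //.
  rewrite /join_map big1 ?cl0 ?inE // => H HD.
  by apply/eqP; have := H0 H HD; rewrite negbK.
have := phiD H HD; rewrite !inE => /andP[fp pHH].
have pHx : phi H \subset cl M [set x].
  by rewrite clx (subset_trans _ (sub_cl M _)) // bigcup_sup.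
exists H => //; apply: (subsetP pHH).
rewrite (@flat_rk_eq _ M _ _ fp pHx) ?(subsetP (sub_cl M _)) ?set11 //.
have [y yp] := set0Pn _ pH.
rewrite rk_cl (leq_trans (rk_le_card M _)) // cards1.
exact: rk_gt0 yp.
Qed.

Lemma bs_bigcup F : flat M F -> \bigcup_(H in maxel (below Bs F)) H = F.
Proof.
move=> fF; apply/eqP; rewrite eqEsubset; apply/andP; split.
  by apply/bigcupsP => H /maxel_belowP[].
apply/subsetP => x /(bs_cover fF)[H HD xH]; apply/bigcupP; by exists H.
Qed.

(** The factor of the join that contains [G] meets every [H] in [S], hence contains it by
    disjointness, hence is the join. *)
Lemma bs_join G (S : {set {set E}}) : G \in Bs -> S \subset Bs ->
  (forall H, H \in S -> exists2 x, x \in H & x \in G) ->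
  cl M (G :|: \bigcup_(H in S) H) \in Bs.
Proof.
move=> GB SB SG; set F := cl M _.
have [K mK GK] : exists2 K, K \in maxel (below Bs F) & G \subset K.
  by apply: maxel_above => //; apply: subset_trans (sub_cl M _); apply: subsetUl.
have [KB KF _] := maxel_belowP mK.
suff -> : F = K by [].
apply/eqP; rewrite eqEsubset KF andbT; apply: cl_sub; first exact: bs_flat.
rewrite subUset GK; apply/bigcupsP => H HS.
have [K' mK' HK'] : exists2 K, K \in maxel (below Bs F) & H \subset K.
  apply: maxel_above; first exact: (subsetP SB).
  apply: subset_trans (sub_cl M _); apply: subset_trans (subsetUr _ _).
  exact: bigcup_sup.
have [x xH xG] := SG H HS.
by rewrite (bs_disj (flat_cl M _) mK mK' (subsetP GK _ xG) (subsetP HK' _ xH)).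
Qed.

Lemma bs_join2 G H x : G \in Bs -> H \in Bs -> x \in H -> x \in G ->
  cl M (H :|: G) \in Bs.
Proof.
move=> GB HB xH xG; have := @bs_join G [set H] GB.
rewrite sub1set big_set1 setUC; apply=> // K.
by rewrite inE => /eqP->; exists x.
Qed.

(** If one factor of the join contains both [B] and [G], it is the join. Otherwise additivity of the
    rank over factors, against [rk_setU], forces the factors to be exactly [B] and [G]. *)
Lemma bs_dichotomy G B : G \in Bs -> B \in Bs ->
  cl M (B :|: G) \in Bs \/
  rk M (B :|: G) = rk M B + rk M G /\
  forall K, K \in Bs -> K \subset cl M (B :|: G) -> K \subset B \/ K \subset G.
Proof.
move=> GB BB; set F := cl M _; have fF : flat M F := flat_cl M _.
have BGF : B :|: G \subset F := sub_cl M _.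
have /andP[BF GF] : (B \subset F) && (G \subset F) by rewrite -subUset.
have [K mK BK] := maxel_above BB BF; have [L mL GL] := maxel_above GB GF.
have [KB KF _] := maxel_belowP mK; have [LB LF _] := maxel_belowP mL.
have [KL|KL] := eqVneq K L.
  left; suff -> : F = K by [].
  apply/eqP; rewrite eqEsubset KF andbT cl_sub ?bs_flat //.
  by rewrite subUset BK KL.
right; have := bs_rk fF; rewrite rk_cl.
rewrite (bigD1 K) //= (bigD1 L) /=; last by rewrite mL eq_sym.
set r := \sum_(_ | _) _ => rE.
have le1 := rk_mono M BK; have le2 := rk_mono M GL; have le3 := rk_setU M B G.
have [eB eG r0] : [/\ rk M K <= rk M B, rk M L <= rk M G & r = 0].
  move: le1 le2 le3; rewrite rE; move: (rk M K) (rk M L) (rk M B) (rk M G) => k l b g.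
  move=> kb lg h; split.
  - rewrite -(leq_add2r g); apply: leq_trans h.
    by rewrite leq_add2l (leq_trans lg) // leq_addr.
  - rewrite -(leq_add2l b); apply: leq_trans h.
    by apply: leq_add => //; apply: leq_addr.
  apply/eqP; rewrite -leqn0 -(leq_add2l (b + g)) addn0.
  apply: leq_trans h; rewrite addnA leq_add2r.
  by apply: leq_add.
have BE : B = K := flat_rk_eq (bs_flat BB) BK eB.
have GE : G = L := flat_rk_eq (bs_flat GB) GL eG.
split; first by rewrite rE r0 addn0 -BE -GE.
move=> H HB HF; have [H' mH' HH'] := maxel_above HB HF.
have [/eqP H'K|H'K] := boolP (H' == K); first by left; rewrite BE -H'K.
have [/eqP H'L|H'L] := boolP (H' == L); first by right; rewrite GE -H'L.
have [H'B _ _] := maxel_belowP mH'; have [x xH'] := set0Pn _ (bs_neq0 H'B).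
have := rk_gt0 loopM xH'; move/eqP: r0.
rewrite sum_nat_eq0 => /forall_inP /(_ H'); rewrite mH' H'K H'L => /(_ isT) /eqP ->.
by [].
Qed.

End BuildingSets.

Local Open Scope ring_scope.

(** * Squarefree monomials up to divisibility, and substitutions *)

Lemma prod_setU (R : comNzRingType) (T : finType) (D S : {set T}) (x : T -> R) :
  exists u, (\prod_(i in D) x i) * (\prod_(i in S) x i) =
            u * \prod_(i in D :|: S) x i.
Proof.
exists (\prod_(i in S :&: D) x i).
rewrite [\prod_(i in S) x i](big_setID D) [\prod_(i in D :|: S) x i](big_setID D).
rewrite /= setUK setDUl setDv set0U.
by rewrite mulrCA.
Qed.

(** Chow relations are indexed by sets while [f] may repeat values; divisibility is all that
    membership in an ideal requires. The same applies to overlapping sets in [prod_setU]. *)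
Lemma prod_imset (R : comNzRingType) (T T' : finType) (P : {set T}) (f : T -> T')
    (x : T' -> R) :
  exists u, \prod_(i in P) x (f i) = u * \prod_(y in f @: P) x y.
Proof.
rewrite (partition_big_imset f) /=.
apply: (big_ind2 (fun a b : R => exists u, a = u * b)) => [|a b c d [u ->] [v ->]|y].
- by exists 1; rewrite mul1r.
- by exists (u * v); rewrite mulrACA.
move=> /imsetP[i iP ->]; rewrite (bigD1 i) /= ?iP ?eqxx //.
by eexists; rewrite mulrC.
Qed.

Lemma prod_sub (R : comNzRingType) (T : finType) (S0 S : {set T}) (x : T -> R) :
  S0 \subset S -> exists u, \prod_(i in S) x i = u * \prod_(i in S0) x i.
Proof.
move=> S0S; exists (\prod_(i in S :\: S0) x i).
by rewrite (big_setID S0) /= (setIidPr S0S) mulrC.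
Qed.

Section MorphismExt.
Variables (K : fieldType) (n : nat) (R : comNzRingType).

Lemma mpoly_morph_ext (f1 f2 : {rmorphism {mpoly K[n]} -> R}) :
  (forall c, f1 c%:MP = f2 c%:MP) -> (forall i, f1 'X_i = f2 'X_i) ->
  forall p, f1 p = f2 p.
Proof.
move=> fC fX p; rewrite [p]mpolyE !rmorph_sum; apply: eq_bigr => m _.
rewrite -mul_mpolyC !rmorphM /= fC mpolyXE_id !rmorph_prod; congr (_ * _).
by apply: eq_bigr => i _; rewrite !rmorphXn /= fX.
Qed.

Lemma mmapX1 (h : {rmorphism K -> R}) (al : 'I_n -> R) i : mmap h al 'X_i = al i.
Proof. by rewrite mmapX mmap1U. Qed.

End MorphismExt.

Lemma mmap_homog (K : fieldType) n m (al : 'I_n -> {mpoly K[m]}) d p :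
  (forall i, al i \is 1.-homog) -> p \is d.-homog ->
  mmap (@mpolyC m K) al p \is d.-homog.
Proof.
move=> alh; move: p; apply: (@homog_ind _ _ d (fun p =>
  is_true (mmap (@mpolyC m K) al p \is d.-homog))) => [|q r qh rh|c q qh|s <-].
- by rewrite mmap0 dhomog0.
- by rewrite mmapD rpredD.
- by rewrite mmapZ mul_mpolyC dhomogZ.
rewrite rmorph_prod; elim: s => [|i s IH]; first by rewrite big_nil dhomog1.
rewrite big_cons; apply: (dhomogM_eq (d1 := 1%N) _ IH) => //.
by rewrite /= mmapX1.
Qed.

(** * Chow presentations with relabelled variables *)

Section Labelled.
Variables (K : fieldType) (E : finType) (n : nat) (ell : 'I_n -> {set E}).
Variables (d : {set {set E}} -> {set E} -> nat).
Variable (g : {set 'I_n} * 'I_n -> {mpoly K[n]}).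
Implicit Types (S : {set {set E}}) (B H : {set E}).
Local Notation Q := {mpoly K[n]}.

Definition label_set : {set {set E}} := [set ell i | i : 'I_n].

(** The value 0 away from the labels lets sums run over any larger family, so that the rings of [M],
    [M|G] and [M/G] share one indexing by subsets of [E]. *)
Definition lvar H : Q := \sum_(i | ell i == H) 'X_i.

(* The Chow presentation with its variables renamed along the labels. *)
Definition labelled_rel : Prop := forall (S : {set 'I_n}) b,
  g (S, b) = (\prod_(i in S) 'X_i) * (\sum_(i | ell b \subset ell i) 'X_i)
    ^+ d (ell @: [set i in S | ell i \proper ell b]) (ell b).

Hypotheses (ell_inj : injective ell) (gE : labelled_rel).

Lemma lvar_ell i : lvar (ell i) = 'X_i.
Proof. by rewrite /lvar (big_pred1 i) // => j; rewrite (inj_eq ell_inj). Qed.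

Lemma lvar_notin H : H \notin label_set -> lvar H = 0.
Proof.
by move=> HL; apply: big_pred0 => i; apply: contraNF HL => /eqP <-; apply: imset_f.
Qed.

Lemma sum_lvar (A : {set {set E}}) (P : pred {set E}) : label_set \subset A ->
  \sum_(H in A | P H) lvar H = \sum_(H in label_set | P H) lvar H.
Proof.
move=> /subsetP LA; rewrite (bigID (mem label_set)) /= [X in _ + X]big1 => [|H].
  rewrite addr0; apply: eq_bigl => H; case: (boolP (H \in label_set)) => HL.
    by rewrite LA // andbT.
  by rewrite andbF.
by case/andP=> _; apply: lvar_notin.
Qed.

Lemma lvar_homog H : lvar H \is 1.-homog.
Proof. by apply: rpred_sum => i _; rewrite dhomogX /= mdeg1. Qed.

Lemma ell_in i : ell i \in label_set.
Proof. exact: imset_f. Qed.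

Lemma sum_label (R : nmodType) (P : pred {set E}) (F : {set E} -> R) :
  \sum_(H in label_set | P H) F H = \sum_(i | P (ell i)) F (ell i).
Proof. by rewrite big_imset_cond //= => i j _ _; apply: ell_inj. Qed.

Definition below_strict S B := [&& B \in label_set, S \subset label_set &
  [forall H in S, H \proper B]].

Lemma lchow_mem S B e : below_strict S B -> (d S B <= e)%N ->
  (\prod_(H in S) lvar H) * (\sum_(H in label_set | B \subset H) lvar H) ^+ e
    \in ideal_gen g.
Proof.
case/and3P=> /imsetP[b _ ->] SB /forall_inP Slt /subnK <-.
pose S0 := ell @^-1: S.
have SE : S = ell @: S0.
  apply/setP => H; apply/idP/imsetP => [HS|[i]]; last by rewrite inE => iS ->.
  by have /imsetP[i _ Hi] := subsetP SB H HS; exists i; rewrite ?inE -?Hi.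
have S0E : [set i in S0 | ell i \proper ell b] = S0.
  by apply/setP => i; rewrite !inE andb_idr // => /Slt.
rewrite exprD mulrCA; apply: ideal_genMl.
have -> : \prod_(H in S) lvar H = \prod_(i in S0) 'X_i.
  rewrite SE big_imset => [|i j _ _]; last exact: ell_inj.
  by apply: eq_bigr => i _; rewrite lvar_ell.
have := ideal_gen_mem g (S0, b); rewrite gE S0E -SE.
by rewrite sum_label; under [\sum_(i | _) lvar _]eq_bigr do rewrite lvar_ell.
Qed.

(** Elements of [S] not strictly below [B] leave the exponent unchanged and merely multiply the
    relation, so only the relations with all of [S] strictly below [B] need testing. *)
Lemma lchow_map (R : comNzRingType) (I : R -> Prop) (f : {rmorphism Q -> R}) :
  is_ideal I ->
  (forall S B, below_strict S B ->
     I ((\prod_(H in S) f (lvar H)) *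
        (\sum_(H in label_set | B \subset H) f (lvar H)) ^+ d S B)) ->
  forall p, p \in ideal_gen g -> I (f p).
Proof.
move=> II If p /ideal_genP[c ->]; rewrite rmorph_sum; apply: ideal_sum => //.
move=> [S b] _; rewrite rmorphM; apply: idealMl => //=.
rewrite gE rmorphM rmorphXn rmorph_sum rmorph_prod /=.
pose S0 := [set i in S | ell i \proper ell b].
have [u ->] : exists u, \prod_(i in S) f 'X_i = u * \prod_(i in S0) f 'X_i.
  by apply: prod_sub; apply/subsetP => i; rewrite inE => /andP[].
rewrite -mulrA; apply: idealMl => //.
have -> : \sum_(i | ell b \subset ell i) f 'X_i =
    \sum_(H in label_set | ell b \subset H) f (lvar H).
  by rewrite sum_label; apply: eq_bigr => i _; rewrite lvar_ell.
have -> : \prod_(i in S0) f 'X_i = \prod_(H in ell @: S0) f (lvar H).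
  rewrite big_imset => [|i j _ _]; last exact: ell_inj.
  by apply: eq_bigr => i _; rewrite lvar_ell.
apply: If; apply/and3P; split; first exact: ell_in.
  by apply/subsetP => _ /imsetP[i _ ->]; apply: ell_in.
by apply/forall_inP => _ /imsetP[i + ->]; rewrite inE => /andP[].
Qed.

Lemma mmap_lvar (R : comNzRingType) (h : {rmorphism K -> R})
    (al : {set E} -> R) H : H \in label_set -> mmap h (al \o ell) (lvar H) = al H.
Proof. by case/imsetP=> i _ ->; rewrite lvar_ell mmapX1. Qed.

Lemma labelled_homog j : exists e, g j \is e.-homog.
Proof.
case: j => S b; rewrite gE.
have sh : \sum_(i | ell b \subset ell i) 'X_i \is [in K[n], 1.-homog].
  by apply: rpred_sum => i _; rewrite dhomogX /= mdeg1.
eexists; apply: dhomogM (dhomogMn _ sh).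
instantiate (1 := #|S|); rewrite -sum1_card.
elim/big_rec2: _ => [|i y p _ ph]; first exact: dhomog1.
by apply: dhomogM ph; rewrite dhomogX /= mdeg1.
Qed.

End Labelled.

Section ChowLabels.
Variables (E E' : finType) (N : matroid E') (Bs : {set {set E'}}).
Variables (ell : 'I_#|Bs| -> {set E}).
Variables (d : {set {set E}} -> {set E} -> nat).

Lemma chow_rel_labelled :
  (forall b i, (bflat b \subset bflat i) = (ell b \subset ell i)) ->
  (forall (S : {set 'I_#|Bs|}) b, (forall i, i \in S -> ell i \proper ell b) ->
     (rk N (bflat b) - rk N (\bigcup_(i in S) bflat i))%N = d (ell @: S) (ell b)) ->
  labelled_rel ell d (chow_rel N (Bs := Bs)).
Proof.
move=> ellS ellR S b; rewrite /chow_rel /=; congr (_ * _ ^+ _).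
  by apply: eq_bigl => i; rewrite ellS.
rewrite /chow_sup rk_cl -ellR => [|i]; last by rewrite inE => /andP[].
congr (_ - rk N _)%N; apply: eq_bigl => i.
by rewrite inE !properE !ellS.
Qed.

End ChowLabels.

(** * The Chow ideal in variables indexed by flats *)

Section StandardLabels.
Variables (E : finType) (M : matroid E) (Bs : {set {set E}}).

Definition rk_gap (S : {set {set E}}) (B : {set E}) : nat :=
  rk M B - rk M (\bigcup_(H in S) H).

Lemma bflat_inj : injective (@bflat E Bs).
Proof. exact: enum_val_inj. Qed.

Lemma bflat_label_set : label_set (@bflat E Bs) = Bs.
Proof.
apply/setP => H; apply/imsetP/idP => [[i _ ->]|HB]; first exact: enum_valP.
by exists (enum_rank_in HB H); rewrite // /bflat enum_rankK_in.
Qed.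

Lemma chow_rel_std : labelled_rel (@bflat E Bs) rk_gap (chow_rel M (Bs := Bs)).
Proof.
apply: chow_rel_labelled => // S b _; rewrite /rk_gap big_imset //=.
by move=> i j _ _; apply: bflat_inj.
Qed.

Definition cvar : {set E} -> {mpoly rat[#|Bs|]} := lvar rat (@bflat E Bs).

Definition csum (B : {set E}) := \sum_(H in Bs | B \subset H) cvar H.

Definition chow_ideal : {mpoly rat[#|Bs|]} -> Prop :=
  fun p => p \in ideal_gen (chow_rel M (Bs := Bs)).

Lemma chow_ideal_ideal : is_ideal chow_ideal.
Proof. exact: ideal_gen_ideal. Qed.

Lemma chow_mem (S : {set {set E}}) B e : B \in Bs -> S \subset Bs ->
  (forall H, H \in S -> H \proper B) ->
  (rk M B <= e + rk M (\bigcup_(H in S) H))%N ->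
  chow_ideal ((\prod_(H in S) cvar H) * csum B ^+ e).
Proof.
move=> BB SB Slt Be.
have := lchow_mem bflat_inj chow_rel_std (S := S) (B := B) (e := e).
rewrite /below_strict bflat_label_set BB SB; apply; first by apply/forall_inP.
by rewrite leq_subLR addnC.
Qed.

Lemma chow_map (R : comNzRingType) (I : R -> Prop)
    (f : {rmorphism {mpoly rat[#|Bs|]} -> R}) : is_ideal I ->
  (forall (S : {set {set E}}) (B : {set E}), B \in Bs -> S \subset Bs ->
     (forall H, H \in S -> H \proper B) ->
     I ((\prod_(H in S) f (cvar H)) *
        (\sum_(H in Bs | B \subset H) f (cvar H)) ^+ rk_gap S B)) ->
  forall p, chow_ideal p -> I (f p).
Proof.
move=> II If p Ip.
apply: (lchow_map bflat_inj chow_rel_std II) Ip => S B.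
by rewrite /below_strict bflat_label_set => /and3P[BB SB /forall_inP]; apply: If.
Qed.

Lemma cvar_homog H : cvar H \is 1.-homog.
Proof. exact: lvar_homog. Qed.

Lemma cvar_bflat i : cvar (bflat i) = 'X_i.
Proof. exact: (lvar_ell _ bflat_inj). Qed.

Lemma mmap_cvar (R : comNzRingType) (h : {rmorphism rat -> R})
    (al : {set E} -> R) H : H \in Bs -> mmap h (al \o @bflat E Bs) (cvar H) = al H.
Proof. by move=> HB; rewrite mmap_lvar ?bflat_label_set //; apply: bflat_inj. Qed.

(** * Relations gained from a monomial whose divisors have union [G] *)

Section Building.
Hypotheses (loopM : loopless M) (bB : building_set M Bs).
Variables (G : {set E}) (D : {set {set E}}).
Hypotheses (DB : D \subset Bs) (DG : \bigcup_(H in D) H = G).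

(** The factor over [D] allows the relation for [D :|: S] to be used, which adjoins [G] to the union
    and so lowers the exponent that is needed. *)
Lemma chow_mem_prod (S : {set {set E}}) (L : {set E}) e : L \in Bs -> S \subset Bs -> G \proper L ->
  (forall H, H \in S -> H \proper L) ->
  (rk M L <= e + rk M (\bigcup_(H in S) H :|: G))%N ->
  chow_ideal ((\prod_(H in D) cvar H) * ((\prod_(H in S) cvar H) * csum L ^+ e)).
Proof.
move=> LB SB GL Slt Le; rewrite mulrA; have [u ->] := prod_setU D S cvar.
rewrite -mulrA; apply: (idealMl chow_ideal_ideal); apply: chow_mem => //.
- by rewrite subUset DB.
- move=> H; rewrite inE => /orP[HD|]; last exact: Slt.
  by apply: sub_proper_trans GL; rewrite -DG bigcup_sup.
by rewrite bigcup_setU DG setUC.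
Qed.

(** [H] and the members of [D] lie strictly below the join of [H] and [G] and already span it, so
    the relation has exponent 0. *)
Lemma chow_mem_bad (H : {set E}) : H \in Bs -> ~~ (H \subset G) -> ~~ (G \subset H) ->
  cl M (H :|: G) \in Bs -> chow_ideal ((\prod_(K in D) cvar K) * cvar H).
Proof.
move=> HB HG GH LB; have HGL := sub_cl M (H :|: G).
have /andP[HL GL] : (H \subset cl M (H :|: G)) && (G \subset cl M (H :|: G)).
  by rewrite -subUset.
have := @chow_mem_prod [set H] (cl M (H :|: G)) 0 LB.
rewrite sub1set HB !big_set1 expr0 mulr1; apply=> //.
- by rewrite properE GL; apply: contra HG; apply: subset_trans.
- move=> _ /set1P->; rewrite properE HL; apply: contra GH.
  exact: subset_trans.
- by rewrite add0n rk_cl.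
Qed.

(* Either cl (B :|: G) is in Bs and csum B may be replaced by csum (cl (B :|: G)), the
   other terms being killed by the product over D, or the relation for B itself
   is already strong enough by submodularity. *)
Lemma chow_mem_join (S : {set {set E}}) (B : {set E}) e : B \in Bs -> ~~ (B \subset G) -> S \subset Bs ->
  (forall H, H \in S -> H \proper B) ->
  cl M (B :|: G) \in Bs \/ rk M (B :|: G) = (rk M B + rk M G)%N ->
  (rk M (B :|: G) <= e + rk M (\bigcup_(H in S) H :|: G))%N ->
  chow_ideal ((\prod_(H in D) cvar H) * ((\prod_(H in S) cvar H) * csum B ^+ e)).
Proof.
move=> BB BG SB Slt dich Be; case: dich => [CB|rkE]; last first.
  apply: (idealMl chow_ideal_ideal); apply: chow_mem => //.
  rewrite -(leq_add2r (rk M G)) -rkE; apply: leq_trans Be _.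
  by rewrite -addnA leq_add2l; apply: rk_setU.
set C := cl M (B :|: G) in CB *; have BGC := sub_cl M (B :|: G).
have /andP[BC GC] : (B \subset C) && (G \subset C) by rewrite -subUset.
have GpC : G \proper C.
  by rewrite properE GC; apply: contra BG; apply: subset_trans.
apply: (ideal_eq chow_ideal_ideal (b := (\prod_(H in D) cvar H) *
   ((\prod_(H in S) cvar H) * csum C ^+ e))); last first.
  apply: chow_mem_prod => //; last by rewrite rk_cl.
  by move=> H /Slt HB; apply: proper_sub_trans HB BC.
rewrite -mulrBr -mulrBr mulrCA; apply: (idealMl chow_ideal_ideal).
apply: (ideal_exp_congr chow_ideal_ideal).
have -> : csum B = csum C +
    \sum_(H in Bs | (B \subset H) && ~~ (C \subset H)) cvar H.
  rewrite /csum (bigID (fun H : {set E} => C \subset H)) /=; congr (_ + _).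
    apply: eq_bigl => H; case: (boolP (H \in Bs)) => //= _.
    by rewrite andb_idl // => CH; apply: subset_trans CH.
  by apply: eq_bigl => H; rewrite andbA.
rewrite addrC addKr mulr_sumr.
apply: (ideal_sum chow_ideal_ideal) => H /and3P[HB BH CH].
have HG : ~~ (H \subset G) by apply: contra BG; apply: subset_trans.
have GH : ~~ (G \subset H).
  apply: contra CH => GH; apply: cl_sub; first exact: (bs_flat bB).
  by rewrite subUset BH GH.
apply: chow_mem_bad => //.
have [x xB] := set0Pn _ (bs_neq0 bB BB).
rewrite (_ : cl M (H :|: G) = cl M (H :|: C)).
  by apply: (@bs_join2 _ _ _ loopM bB _ _ x) => //; [apply: (subsetP BH)|apply: (subsetP BC)].
apply/eqP; rewrite eqEsubset !cl_sub ?flat_cl //.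
  rewrite subUset (subset_trans _ (sub_cl M _)) ?subsetUl //=.
  apply: cl_sub; first exact: flat_cl.
  by apply: subset_trans (sub_cl M _); rewrite setSU.
by apply: subset_trans (sub_cl M _); rewrite setUS.
Qed.

End Building.
End StandardLabels.

(** * Combinatorics of the removal of [G] *)

Section RemoveElement.
Variables (E : finType) (M : matroid E) (Gs : {set {set E}}) (G : {set E}).
Hypotheses (loopM : loopless M) (bG : building_set M Gs) (GG : G \in Gs).
Hypothesis (bG' : building_set M (Gs :\ G)).
Implicit Types (B F H K h : {set E}) (S : {set {set E}}).

Local Notation Gs' := (Gs :\ G).
Local Notation cl := (cl M).

Definition factors : {set {set E}} := maxel (below Gs' G).
Local Notation Hs := factors.

(* The divisor of H misses the centre of the blow-up if H is bad; if H is good it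
   restricts to the variable of cl (H :|: G) in the factor D(M/G) of the centre. *)
Definition bad H := [&& H \in Gs', ~~ (H \subset G), ~~ (G \subset H)
  & cl (H :|: G) \in Gs'].
Definition good H := [&& H \in Gs', ~~ (H \subset G) & ~~ bad H].

Let fG : flat M G := bs_flat bG GG.

Lemma sub_Gs H : H \in Gs' -> H \in Gs.
Proof. by rewrite inE => /andP[]. Qed.

Lemma in_Gs' H : H \in Gs -> ~~ (H \subset G) -> H \in Gs'.
Proof. by move=> HG HsG; rewrite !inE HG andbT; apply: contraNneq HsG => ->. Qed.

Lemma hsP h : h \in Hs -> [/\ h \in Gs', h \subset G
  & forall K, K \in Gs' -> K \subset G -> h \subset K -> h = K].
Proof. exact: maxel_belowP. Qed.

Lemma hs_sub h : h \in Hs -> h \in Gs'. Proof. by case/hsP. Qed.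

Lemma hs_proper h : h \in Hs -> h \proper G.
Proof. by case/hsP; rewrite !inE => /andP[hG _] hsG _; rewrite properEneq hG. Qed.

Lemma hs_bigcup : \bigcup_(h in Hs) h = G.
Proof. exact: (bs_bigcup loopM bG' fG). Qed.

Lemma hs_uniq h h' x : h \in Hs -> h' \in Hs -> x \in h -> x \in h' -> h = h'.
Proof. exact: (bs_disj loopM bG' fG). Qed.

Lemma hs_above B : B \in Gs' -> B \subset G -> exists2 h, h \in Hs & B \subset h.
Proof. exact: maxel_above. Qed.

Lemma hs_card_gt0 : (0 < #|Hs|)%N.
Proof.
have [x xG] := set0Pn _ (bs_neq0 bG GG).
have [h hH _] := bs_cover loopM bG' fG xG.
by apply/card_gt0P; exists h.
Qed.

(** The factors are disjoint and [B] is nonempty, so at most one factor lies above [B]. Hence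
    shifting all factor variables by one element changes a sum above [B] by that element or not at
    all. *)
Lemma hs_count (R : pzSemiRingType) B : B \in Gs' ->
  \sum_(H in Gs' | B \subset H) (H \in Hs)%:R = (B \subset G)%:R :> R.
Proof.
move=> BG; have [x xB] := set0Pn _ (bs_neq0 bG' BG).
case: (boolP (B \subset G)) => sBG; last first.
  rewrite big1 // => H /andP[_ BH]; case: (boolP (H \in Hs)) => // /hsP[_ HG _].
  by case/negP: sBG; apply: subset_trans HG.
have [h hH Bh] := hs_above BG sBG.
rewrite (bigD1 h) /= ?hs_sub ?Bh // hH big1 ?addr0 // => H /andP[/andP[_ BH] Hh].
case: (boolP (H \in Hs)) => // HH; case/eqP: Hh.
exact: hs_uniq HH hH (subsetP BH _ xB) (subsetP Bh _ xB).
Qed.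

Lemma sum_Gs (R : nmodType) (P : pred {set E}) (F : {set E} -> R) :
  \sum_(H in Gs | P H) F H =
  (if P G then F G else 0) + \sum_(H in Gs' | P H) F H.
Proof. by rewrite big_mkcondr (big_setD1 G) //= -big_mkcondr. Qed.

Lemma sub_clU B : (B \subset cl (B :|: G)) * (G \subset cl (B :|: G)).
Proof.
by have := sub_cl M (B :|: G); rewrite subUset => /andP[-> ->].
Qed.

Lemma clU_in B : cl (B :|: G) \in Gs -> ~~ (B \subset G) -> cl (B :|: G) \in Gs'.
Proof.
move=> CG BG; apply: in_Gs' => //; apply: contra BG.
by apply: subset_trans; rewrite sub_clU.
Qed.

Lemma meet_clU H x : H \in Gs' -> ~~ (H \subset G) -> x \in H -> x \in G ->
  cl (H :|: G) \in Gs'.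
Proof.
by move=> /sub_Gs HG HsG xH xG; apply: clU_in => //; apply: (bs_join2 loopM bG GG HG xH xG).
Qed.

Lemma dichotomy B : B \in Gs' -> ~~ (B \subset G) ->
  cl (B :|: G) \in Gs' \/
  rk M (B :|: G) = (rk M B + rk M G)%N /\
  forall K, K \in Gs' -> K \subset cl (B :|: G) -> K \subset B \/ K \subset G.
Proof.
move=> BG BsG; have [CG|[rkE H]] := bs_dichotomy loopM bG GG (sub_Gs BG).
  by left; apply: clU_in.
by right; split=> // K /sub_Gs; apply: H.
Qed.

Lemma goodP H : good H -> [/\ H \in Gs', ~~ (H \subset G)
  & cl (H :|: G) \in Gs' -> G \subset H].
Proof.
case/and3P=> HG HsG; rewrite /bad HG HsG /= negb_and negbK => nb; split=> //.
by move=> CG; move: nb; rewrite CG orbF.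
Qed.

Lemma good_meet H x : good H -> x \in H -> x \in G -> G \subset H.
Proof. by move=> /goodP[HG HsG CH] xH xG; apply/CH/(meet_clU HG HsG xH xG). Qed.

Lemma good_super H : H \in Gs' -> G \subset H -> good H.
Proof.
move=> HG GH; rewrite /good /bad HG GH /= andbF andbT.
by move: HG; rewrite !inE => /andP[HG _]; apply: contra HG => HsG; rewrite eqEsubset HsG.
Qed.

(** If the join of [H] and [G] is in [Gs'], goodness makes it equal to [H]; otherwise the dichotomy
    puts [B] below [H]. So a good element is determined by its join with [G]. *)
Lemma good_max H B : good H -> B \in Gs' -> ~~ (B \subset G) ->
  B \subset cl (H :|: G) -> B \subset H.
Proof.
move=> /goodP[HG HsG CH] BG BsG BC.
have [/CH GH|[_ /(_ B BG BC)[//|]]] := dichotomy HG HsG.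
  apply: subset_trans BC _; apply: cl_sub; first exact: (bs_flat bG').
  by rewrite subUset subxx.
by rewrite (negPf BsG).
Qed.

(** With [good_max] this makes the good elements a system of representatives for the building set of
    [M/G]. *)
Lemma good_rep B : B \in Gs' -> ~~ (B \subset G) ->
  exists2 C, good C & B \subset C /\ cl (C :|: G) = cl (B :|: G).
Proof.
move=> BG BsG; have [bB|nbB] := boolP (bad B); last by exists B; rewrite // /good BG BsG.
exists (cl (B :|: G)).
  by case/and4P: bB => _ _ _ CG; apply: good_super => //; rewrite sub_clU.
split; first by rewrite sub_clU.
by rewrite (setUidPl _) ?sub_clU // cl_id // flat_cl.
Qed.

Lemma good_sub_rep B C K : good C -> B \subset C -> cl (C :|: G) = cl (B :|: G) ->
  good K -> ~~ (C \subset G) -> (B \subset K) = (C \subset K).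
Proof.
move=> gC BC clE gK CsG; apply/idP/idP => [BK|]; last exact: subset_trans.
have [CG _ _] := goodP gC.
apply: good_max => //; apply: subset_trans (_ : cl (B :|: G) \subset _).
  by rewrite -clE sub_clU.
apply: cl_sub; first exact: flat_cl.
by apply: subset_trans (sub_cl M _); rewrite setSU.
Qed.

Lemma trichotomy H : H \in Gs' -> [\/ H \subset G, good H | bad H].
Proof.
move=> HG; have [|HsG] := boolP (H \subset G); first by constructor 1.
have [|nb] := boolP (bad H); first by constructor 3.
by constructor 2; rewrite /good HG HsG.
Qed.

Lemma badP H : bad H -> [/\ H \in Gs', ~~ (H \subset G), ~~ (G \subset H)
  & cl (H :|: G) \in Gs'].
Proof. by case/and4P. Qed.

(** * The ideal of the centre and the substitution from [Gs'] to [Gs] *)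

Local Notation Q := {mpoly rat[#|Gs|]}.
Local Notation Q' := {mpoly rat[#|Gs'|]}.
Local Notation x := (@cvar E Gs).
Local Notation x' := (@cvar E Gs').
Local Notation y := (@csum E Gs).
Local Notation y' := (@csum E Gs').
Local Notation I := (@chow_ideal E M Gs).
Local Notation I' := (@chow_ideal E M Gs').

Let II : is_ideal I := @chow_ideal_ideal E M Gs.
Let II' : is_ideal I' := @chow_ideal_ideal E M Gs'.

Definition join_gap S B : nat :=
  rk M (B :|: G) - rk M (\bigcup_(H in S) H :|: G).

(* The ideal of the classes of D(M, Gs') that vanish on the centre of the
   blow-up that turns D(M, Gs') into D(M, Gs). *)
Inductive centre_gen : Q' -> Prop :=
| centre_bad H : bad H -> centre_gen (x' H)
| centre_low S B : B \in Gs' -> B \subset G -> S \subset Gs' ->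
    (forall H, H \in S -> H \proper B) ->
    centre_gen ((\prod_(H in S) x' H) * y' B ^+ rk_gap M S B)
| centre_high S B : B \in Gs' -> ~~ (B \subset G) -> S \subset Gs' ->
    (forall H, H \in S -> H \proper B) ->
    (forall H, H \in S -> ~~ (H \subset G)) ->
    centre_gen ((\prod_(H in S) x' H) * y' B ^+ join_gap S B).

Definition centre_ideal : Q' -> Prop := ideal_span centre_gen.
Local Notation J := centre_ideal.

Let IJ : is_ideal J := ideal_span_ideal centre_gen.

Lemma centre_ideal_bad H : bad H -> J (x' H).
Proof. by move=> bH; apply/ideal_span_gen/centre_bad. Qed.

Lemma bigcupU_not_sub S :
  \bigcup_(H in [set H in S | ~~ (H \subset G)]) H :|: G = \bigcup_(H in S) H :|: G.
Proof.
apply/eqP; rewrite eqEsubset !subUset !subsetUr !andbT; apply/andP; split.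
  apply/bigcupsP => H; rewrite inE => /andP[HS _].
  by apply: subset_trans (subsetUl _ _); apply: bigcup_sup.
apply/bigcupsP => H HS; have [HG|HG] := boolP (H \subset G).
  exact: subset_trans HG (subsetUr _ _).
by apply: subset_trans (subsetUl _ _); apply: bigcup_sup; rewrite inE HS.
Qed.

(** Members of [S] below [G] do not affect the join with [G]; dropping them leads to a generator. *)
Lemma centre_ideal_high S B e : B \in Gs' -> ~~ (B \subset G) -> S \subset Gs' ->
  (forall H, H \in S -> H \proper B) -> (join_gap S B <= e)%N ->
  J ((\prod_(H in S) x' H) * y' B ^+ e).
Proof.
move=> BG BsG SG SB /subnK <-; rewrite exprD mulrCA; apply: idealMl => //.
pose S0 := [set H in S | ~~ (H \subset G)].
have S0S : S0 \subset S by apply/subsetP => H; rewrite inE => /andP[].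
have [u ->] := prod_sub x' S0S; rewrite -mulrA; apply: idealMl => //.
rewrite /join_gap -bigcupU_not_sub; apply/ideal_span_gen/centre_high => //.
- exact: subset_trans SG.
- by move=> H /(subsetP S0S); apply: SB.
- by move=> H; rewrite inE => /andP[].
Qed.

Lemma bigcup_lt S B : (forall H, H \in S -> H \proper B) ->
  \bigcup_(H in S) H \subset B.
Proof. by move=> SB; apply/bigcupsP => H /SB/proper_sub. Qed.

Lemma join_gap_le S B : (forall H, H \in S -> H \proper B) ->
  (join_gap S B <= rk_gap M S B)%N.
Proof. by move=> /bigcup_lt SB; apply: rk_sub_setU. Qed.

Lemma chow_sub_centre p : I' p -> J p.
Proof.
apply: (chow_map (f := idfun) IJ) => S B BG SG SB /=.
have [BsG|BsG] := boolP (B \subset G); first exact/ideal_span_gen/centre_low.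
by apply: centre_ideal_high => //; apply: join_gap_le.
Qed.

(** The pullback of divisors: those of the factors pass through the centre and acquire the
    exceptional divisor [x G]. *)
Definition blow_var H : Q := x H + (H \in Hs)%:R * x G.

Definition pi : Q' -> Q := mmap (@mpolyC #|Gs| rat) (blow_var \o @bflat E Gs').
HB.instance Definition _ := GRing.RMorphism.on pi.

Lemma pi_x H : H \in Gs' -> pi (x' H) = blow_var H.
Proof. by move=> HG; rewrite /pi mmap_cvar. Qed.

Lemma pi_x_notin H : H \in Gs' -> H \notin Hs -> pi (x' H) = x H.
Proof. by move=> HG /negPf Hh; rewrite pi_x // /blow_var Hh mul0r addr0. Qed.

Lemma sum_blow_var B : B \in Gs' ->
  \sum_(H in Gs' | B \subset H) blow_var H = y B.
Proof.
move=> BG; rewrite /csum sum_Gs big_split /= -mulr_suml hs_count // addrC.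
by congr (_ + _); case: ifP; rewrite ?mul1r ?mul0r.
Qed.

Lemma pi_y B : B \in Gs' -> pi (y' B) = y B.
Proof.
move=> BG; rewrite -sum_blow_var // rmorph_sum /=; apply: eq_bigr => H /andP[HG _].
exact: pi_x.
Qed.

Let DG1 : \bigcup_(H in [set G]) H = G. Proof. exact: big_set1. Qed.
Let DB1 : [set G] \subset Gs. Proof. by rewrite sub1set. Qed.

Lemma subset_Gs S : S \subset Gs' -> S \subset Gs.
Proof. by move=> SG; apply: subset_trans SG (subsetDl _ _). Qed.

Lemma dichotomy_rk B : B \in Gs' -> ~~ (B \subset G) ->
  cl (B :|: G) \in Gs' \/ rk M (B :|: G) = (rk M B + rk M G)%N.
Proof. by move=> BG BsG; have [|[]] := dichotomy BG BsG; [left|right]. Qed.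

Lemma xG_join S B e : B \in Gs' -> ~~ (B \subset G) -> S \subset Gs' ->
  (forall H, H \in S -> H \proper B) -> (join_gap S B <= e)%N ->
  I (x G * ((\prod_(H in S) x H) * y B ^+ e)).
Proof.
move=> BG BsG SG SB; rewrite leq_subLR addnC => Be.
have := @chow_mem_join E M Gs loopM bG G [set G] DB1 DG1 S B e.
rewrite big_set1; apply=> //; first exact: sub_Gs.
  exact: subset_Gs.
by have [/sub_Gs|] := dichotomy_rk BG BsG; [left|right].
Qed.

Lemma pi_chow p : I' p -> I (pi p).
Proof.
apply: chow_map => // S B BG SG SB.
have -> : \sum_(H in Gs' | B \subset H) pi (x' H) = y B.
  by rewrite -pi_y // rmorph_sum.
have piS H : H \in S -> pi (x' H) = blow_var H.
  by move=> HS; rewrite pi_x // (subsetP SG).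
rewrite (eq_bigr _ piS) /blow_var.
have IxS : I ((\prod_(H in S) x H) * y B ^+ rk_gap M S B).
  apply: chow_mem => //; [exact: sub_Gs|exact: subset_Gs|].
  by rewrite addnC -leq_subLR.
have [BsG|BsG] := boolP (B \subset G).
  (* An element strictly below [B] is not maximal below [G], so the substitution leaves the monomial
     alone. *)
  rewrite [X in X * _](_ : _ = \prod_(H in S) x H) //; apply: eq_bigr => H HS.
  case: (boolP (H \in Hs)) => [/hsP[_ _ maxH]|]; last by rewrite mul0r addr0.
  have := SB H HS; rewrite properE => /andP[HB /negP[]].
  by rewrite -(maxH B BG BsG HB).
(* Expand in [x G]: the constant term is a relation for [Gs], and in the rest the product over
   [S :\: Hs] survives, whose join with [G] is that of [S]. *)
rewrite (bigID (mem Hs)) /=.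
have [u ->] := prodDE (index_enum {set E}) (fun H => (H \in S) && (H \in Hs))
   x (fun H => (H \in Hs)%:R) (x G).
rewrite [X in _ * X * _](_ : _ = \prod_(H in S | H \notin Hs) x H); last first.
  by apply: eq_bigr => H /andP[_ /negPf->]; rewrite mul0r addr0.
rewrite mulrDl mulrDl; apply: idealD => //; first by rewrite -bigID.
pose S0 := S :\: Hs; have S0S : S0 \subset S by apply: subsetDl.
rewrite [X in x G * u * X * _](_ : _ = \prod_(H in S0) x H); last first.
  by apply: eq_bigl => H; rewrite /S0 in_setD andbC.
rewrite -!mulrA mulrCA; apply: idealMl => //; apply: xG_join => //.
- exact: subset_trans S0S SG.
- by move=> H /(subsetP S0S); apply: SB.
apply: leq_trans (join_gap_le SB).
rewrite /join_gap (_ : \bigcup_(H in S0) H :|: G = \bigcup_(H in S) H :|: G) //.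
rewrite -(bigcupU_not_sub S0) -(bigcupU_not_sub S); congr (_ :|: _).
apply: eq_bigl => H; rewrite in_set in_setD [RHS]in_set.
case: (boolP (H \in Hs)) => [/hsP[_ HG _]|_] //=.
by rewrite HG andbF.
Qed.

Lemma pi_centre p : J p -> I (x G * pi p).
Proof.
have IIt : is_ideal (fun p => I (x G * pi p)).
  split=> [|a b Ia Ib|a b Ib]; first by rewrite rmorph0 mulr0; apply: ideal0.
    by rewrite rmorphD mulrDr; apply: idealD.
  by rewrite rmorphM mulrCA; apply: idealMl.
apply: ideal_span_sub IIt _ p => p; case=> [H bH|S B BG BsG SG SB|S B BG BsG SG SB SsG].
- have [HG HsG GH CG] := badP bH; rewrite pi_x_notin //; last first.
    by apply: contra HsG => /hsP[].
  have := @chow_mem_bad E M Gs G [set G] DB1 DG1 H; rewrite big_set1; apply=> //.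
    exact: sub_Gs.
  exact: sub_Gs.
- by apply: idealMl => //; apply: pi_chow; apply: chow_mem => //; rewrite addnC -leq_subLR.
rewrite rmorphM rmorphXn rmorph_prod /= pi_y //.
rewrite (eq_bigr x) => [|H HS]; first exact: xG_join.
by rewrite pi_x_notin ?(subsetP SG) //; apply: contra (SsG H HS) => /hsP[].
Qed.

Definition hs_vars : seq Q' := [seq x' h | h <- enum Hs].

Lemma prod_hs_vars (R : comNzRingType) (F : Q' -> R) :
  \prod_(p <- hs_vars) F p = \prod_(h in Hs) F (x' h).
Proof. by rewrite big_map big_enum. Qed.

(** Each [x G - pi (x' h)] is [- x h], and the factors lie strictly below [G] with union [G], so
    their monomial is the relation at [G] with exponent 0. *)
Lemma prod_hs_chow : I (\prod_(p <- hs_vars) (x G - pi p)).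
Proof.
rewrite prod_hs_vars.
have [u ->] : exists u, \prod_(h in Hs) (x G - pi (x' h)) = u * \prod_(h in Hs) x h.
  exists (\prod_(h in Hs) (- 1)); rewrite -big_split; apply: eq_bigr => h hH /=.
  by rewrite pi_x ?hs_sub // /blow_var hH mul1r opprD addrCA subrr addr0 mulN1r.
apply: idealMl => //; rewrite -[X in I X]mulr1 -(expr0 (y G)).
apply: chow_mem => //; last by rewrite hs_bigcup.
  by apply/subsetP => h /hs_sub/sub_Gs.
exact: hs_proper.
Qed.

Let HsG' : Hs \subset Gs'. Proof. by apply/subsetP => h /hs_sub. Qed.

(** The monomial of the factors stands in for the missing variable of [G]: it adjoins [G] to every
    relation, after which [join_gap] is a sufficient exponent. *)
Lemma prod_hs_centre p : J p -> I' ((\prod_(q <- hs_vars) q) * p).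
Proof.
rewrite (prod_hs_vars id).
have IIt : is_ideal (fun p => I' ((\prod_(h in Hs) x' h) * p)).
  split=> [|a b Ia Ib|a b Ib]; first by rewrite mulr0; apply: ideal0.
    by rewrite mulrDr; apply: idealD.
  by rewrite mulrCA; apply: idealMl.
apply: ideal_span_sub IIt _ p => p; case=> [H bH|S B BG BsG SG SB|S B BG BsG SG SB SsG].
- have [HG HsG GH CG] := badP bH.
  exact: (chow_mem_bad HsG' hs_bigcup HG HsG GH CG).
- by apply: idealMl => //; apply: chow_mem => //; rewrite addnC -leq_subLR.
apply: (chow_mem_join loopM bG' HsG' hs_bigcup) => //; first exact: dichotomy_rk.
by rewrite addnC -leq_subLR.
Qed.

(** * The inverse substitution and the relations at [G] *)

Definition psi_var H : {poly Q'} :=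
  if H == G then 'X else (x' H)%:P + (- (H \in Hs)%:R) * 'X.

Definition psi : Q -> {poly Q'} :=
  mmap (polyC \o @mpolyC #|Gs'| rat) (psi_var \o @bflat E Gs).
HB.instance Definition _ := GRing.RMorphism.on psi.

Lemma psi_x H : H \in Gs -> psi (x H) = psi_var H.
Proof. by move=> HG; rewrite /psi mmap_cvar. Qed.

Lemma psi_var_in H : H \in Gs' ->
  psi_var H = (x' H)%:P + (- (H \in Hs)%:R) * 'X.
Proof. by rewrite in_setD1 /psi_var => /andP[/negPf-> _]. Qed.

Lemma psi_var_notin H : H \in Gs' -> H \notin Hs -> psi_var H = (x' H)%:P.
Proof. by move=> HG /negPf Hh; rewrite psi_var_in // Hh oppr0 mul0r addr0. Qed.

Lemma sum_psi_var B : B \in Gs' ->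
  \sum_(H in Gs | B \subset H) psi_var H = (y' B)%:P.
Proof.
move=> BG; rewrite sum_Gs {1}/psi_var eqxx.
rewrite (eq_bigr (fun H => (x' H)%:P + (- (H \in Hs)%:R) * 'X)); last first.
  by move=> H /andP[HG _]; apply: psi_var_in.
rewrite big_split /= -mulr_suml sumrN hs_count // rmorph_sum addrCA.
rewrite [X in _ + X](_ : _ = 0) ?addr0 //.
by case: ifP => _; [rewrite mulN1r subrr|rewrite oppr0 mul0r addr0].
Qed.

Local Notation KI := (keel_ideal I' J hs_vars).

Let IK : is_ideal KI := keel_ideal_ideal II' IJ hs_vars.

Lemma keel_bad H : bad H -> KI ('X * (x' H)%:P).
Proof. by move=> bH; apply: keel_idealXC => //; apply: centre_ideal_bad. Qed.

(** If [f] fixes all factors the product is [P] up to sign. Otherwise some [f h0] is bad by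
    maximality of [h0]: it kills the terms with ['X]. The term without ['X] is a relation with
    exponent 0 at the join of the [f h], whose union contains [G] and which lies in [Gs']. *)
Lemma keel_choice (f : {set E} -> {set E}) :
  (forall h, h \in Hs -> [/\ f h \in Gs, h \subset f h & ~~ (G \subset f h)]) ->
  KI (\prod_(h in Hs) psi_var (f h)).
Proof.
move=> fP.
have fG' h : h \in Hs -> f h \in Gs'.
  move=> /fP[fh _ Gf]; rewrite !inE fh andbT; apply: contraNneq Gf => ->.
  exact: subxx.
have [/forall_inP fid|] := boolP [forall h in Hs, f h == h].
  have [u ->] : exists u, \prod_(h in Hs) psi_var (f h) =
      u * \prod_(p <- hs_vars) ('X - p%:P).
    exists (\prod_(h in Hs) (- 1)); rewrite (prod_hs_vars (fun p => 'X - p%:P)).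
    rewrite -big_split; apply: eq_bigr => h hH /=.
    by rewrite (eqP (fid h hH)) psi_var_in ?hs_sub // hH !mulN1r opprB.
  by apply: idealMl => //; apply: keel_idealP.
rewrite negb_forall_in => /exists_inP[h0 h0H fh0].
have [f0G h0f Gf] := fP h0 h0H; have f0G' := fG' h0 h0H.
have f0sG : ~~ (f h0 \subset G).
  apply: contra fh0 => f0sG; have [_ _ max0] := hsP h0H.
  by rewrite -(max0 (f h0)).
have [z zh0] := set0Pn _ (bs_neq0 bG' (hs_sub h0H)).
have [_ h0sG _] := hsP h0H.
have bf0 : bad (f h0).
  rewrite /bad f0G' f0sG Gf /=.
  exact: meet_clU f0G' f0sG (subsetP h0f _ zh0) (subsetP h0sG _ zh0).
rewrite (bigD1 h0) //= psi_var_notin //; last by apply: contra f0sG => /hsP[].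
rewrite (eq_bigr (fun h => (x' (f h))%:P + (- (f h \in Hs)%:R) * 'X)); last first.
  by move=> h /andP[hH _]; apply/psi_var_in/fG'.
have [u ->] := prodDE (index_enum {set E}) (fun h => (h \in Hs) && (h != h0))
  (fun h => (x' (f h))%:P) (fun h => - (f h \in Hs)%:R) 'X.
rewrite mulrDr mulrA [_ * 'X]mulrC; apply: idealD => //; last first.
  by apply: idealMr => //; apply: keel_bad.
rewrite -rmorph_prod -rmorphM; apply: keel_idealC => //; first exact: chow_sub_centre.
have -> : x' (f h0) * \prod_(h in Hs | h != h0) x' (f h) = \prod_(h in Hs) x' (f h).
  by rewrite [RHS](bigD1 h0).
have [v ->] := prod_imset Hs f x'; apply: idealMl => //.
rewrite -[X in I' X]mulr1; pose B := cl (G :|: \bigcup_(H in f @: Hs) H).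
rewrite -(expr0 (y' B)).
have fsub h : h \in Hs -> f h \subset \bigcup_(H in f @: Hs) H.
  by move=> hH; apply: bigcup_sup; apply: imset_f.
have UB : G :|: \bigcup_(H in f @: Hs) H \subset B := sub_cl M _.
have BG : B \in Gs.
  apply: bs_join => //; first by apply/subsetP => _ /imsetP[h /fP[+ _ _] ->].
  move=> _ /imsetP[h hH ->]; have [_ hf _] := fP h hH.
  have [w wh] := set0Pn _ (bs_neq0 bG' (hs_sub hH)); exists w.
    exact: (subsetP hf).
  by have [_ hG _] := hsP hH; apply: (subsetP hG).
have Bf h : h \in Hs -> f h \subset B.
  by move=> hH; apply: subset_trans (fsub h hH) (subset_trans (subsetUr _ _) UB).
apply: chow_mem.
- by apply: in_Gs' => //; apply: contra f0sG; apply: subset_trans; apply: Bf.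
- by apply/subsetP => _ /imsetP[h /fG' + ->].
- move=> _ /imsetP[h hH ->]; rewrite properE Bf //=; have [_ _] := fP h hH.
  by apply: contra; apply: subset_trans; apply: subset_trans (subsetUl _ _) UB.
rewrite add0n rk_cl (setUidPr _) // -hs_bigcup; apply/bigcupsP => h hH.
by have [_ hf _] := fP h hH; apply: subset_trans hf (fsub h hH).
Qed.

Lemma keel_prod_sum (A : {set E} -> {set {set E}}) :
  (forall h K, h \in Hs -> K \in A h ->
     [/\ K \in Gs, h \subset K & ~~ (G \subset K)]) ->
  KI (\prod_(h in Hs) \sum_(K in A h) psi_var K).
Proof.
move=> AP; rewrite (big_distr_big_dep set0) /=; apply: ideal_sum => // f fA.
apply: keel_choice => h hH; apply: AP => //.
by case/pfamilyP: fA => _ /(_ h hH).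
Qed.

(* With Y the sum in the goal, Y is congruent to y' h up to the sum of the psi_var K
   over the K above h but not above G, for each factor h of G; multiplying over
   the factors leaves a product of such sums, which lies in the ideal. *)
Lemma keel_top S : S \subset Gs' -> (forall H, H \in S -> H \proper G) ->
  KI ((\prod_(H in S) psi_var H) *
      (\sum_(H in Gs | G \subset H) psi_var H) ^+ rk_gap M S G).
Proof.
move=> SG SltG; set Y := \sum_(H in Gs | _) _.
pose r H := odflt set0 [pick h in Hs | H \subset h].
have rP H : H \in S -> r H \in Hs /\ H \subset r H.
  move=> HS; rewrite /r; case: pickP => [h /andP[]//|] no.
  have [h hH Hh] := hs_above (subsetP SG H HS) (proper_sub (SltG H HS)).
  by have := no h; rewrite /= hH Hh.
pose Sh h := [set H in S | r H == h].
have ShP h H : H \in Sh h -> H \in S /\ H \subset h.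
  by rewrite inE => /andP[HS /eqP <-]; have [_] := rP H HS.
pose eh h := (rk M h - rk M (\bigcup_(H in Sh h) H))%N.
(* Rank is additive over the factors and subadditive on unions, so the exponents needed for the
   separate factors fit into the one available. *)
have le_e : (\sum_(h in Hs) eh h <= rk_gap M S G)%N.
  rewrite /eh sumnB => [|h hH]; last first.
    by apply: rk_mono; apply/bigcupsP => H /ShP[].
  rewrite /rk_gap (bs_rk bG' fG); apply: leq_sub2l.
  apply: leq_trans (rk_bigcup M _ _); apply: rk_mono; apply/bigcupsP => H HS.
  have [rH Hr] := rP H HS; apply: subset_trans (bigcup_sup (r H) rH).
  by apply: (bigcup_sup H); rewrite inE HS eqxx.
(* For [h] in [S] the variable of [h] already divides [T h] and is itself the chosen term. *)
pose A h := if h \in S then [set h] else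
  [set K in Gs | (h \subset K) && ~~ (G \subset K)].
pose T h := (\prod_(H in Sh h) psi_var H) * Y ^+ eh h.
have TW h : exists s, h \in Hs -> KI (T h - (\sum_(K in A h) psi_var K) * s).
  have [hH|] := boolP (h \in Hs); last by exists 0.
  have [hG' hsG maxh] := hsP hH.
  rewrite /A; case: ifPn => hS.
    have hSh : h \in Sh h.
      rewrite inE hS eq_sym; have [rH hr] := rP h hS; have [rG rsG _] := hsP rH.
      by apply/eqP/maxh.
    rewrite /T (bigD1 h) //= big_set1 -mulrA.
    exists ((\prod_(H in Sh h | H != h) psi_var H) * Y ^+ eh h) => _.
    by rewrite subrr; apply: ideal0.
  have SltH H : H \in Sh h -> H \proper h.
    move=> /ShP[HS Hh]; rewrite properEneq Hh andbT.
    by apply: contraNneq hS => <-.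
  have SnH H : H \in Sh h -> H \notin Hs.
    move=> HSh; have HltH := SltH H HSh; apply/negP => /hsP[_ _ maxH].
    have Hh := maxH h hG' hsG (proper_sub HltH).
    by move: HltH; rewrite Hh properxx.
  have prodE : \prod_(H in Sh h) psi_var H = (\prod_(H in Sh h) x' H)%:P.
    rewrite rmorph_prod; apply: eq_bigr => H HSh; apply: psi_var_notin.
      by have [HS _] := ShP h H HSh; apply: (subsetP SG).
    exact: SnH.
  set V := \sum_(K in _) _.
  have VE : (y' h)%:P - Y = V.
    have -> : (y' h)%:P = Y + V.
      rewrite -sum_psi_var // (bigID (fun H : {set E} => G \subset H)) /=.
      congr (_ + _); apply: eq_bigl => H; last by rewrite inE andbA.
      case: (H \in Gs) => //=.
      by rewrite andb_idl // => GH; apply: subset_trans GH.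
    by rewrite addrC addKr.
  have [s subE] : exists s, (y' h)%:P ^+ eh h - Y ^+ eh h = V * s.
    by eexists; rewrite subrXX VE.
  exists (- ((\prod_(H in Sh h) psi_var H) * s)) => _.
  rewrite mulrN opprK /T mulrCA -subE -mulrDr addrCA subrr addr0 prodE.
  rewrite -rmorphXn -rmorphM; apply: keel_idealC => //; first exact: chow_sub_centre.
  apply: chow_mem => //; last by rewrite addnC -leq_subLR.
  by apply/subsetP => H /ShP[HS _]; apply: (subsetP SG).
have [s sE] := choice TW.
have -> : \prod_(H in S) psi_var H = \prod_(h in Hs) \prod_(H in Sh h) psi_var H.
  rewrite (partition_big r (mem Hs)) => [|H HS]; last by have [] := rP H HS.
  by apply: eq_bigr => h _; apply: eq_bigl => H; rewrite inE.
rewrite -(subnKC le_e) exprD mulrA; apply: idealMr => //.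
rewrite -prodrXr -big_split /=.
apply: (ideal_eq IK (b := \prod_(h in Hs) ((\sum_(K in A h) psi_var K) * s h))).
  by apply: ideal_prod_congr.
rewrite big_split; apply: idealMr => //; apply: keel_prod_sum => h K hH.
rewrite /A; case: ifP => _; last by rewrite inE => /and3P[].
move=> /set1P->; split=> //; first exact/sub_Gs/hs_sub.
by have := hs_proper hH; rewrite properE => /andP[].
Qed.

Lemma psi_chow q : I q -> KI (psi q).
Proof.
apply: chow_map => // S B BG SG SB.
have psiS H : H \in S -> psi (x H) = psi_var H.
  by move=> HS; rewrite psi_x // (subsetP SG).
have -> : \prod_(H in S) psi (x H) = \prod_(H in S) psi_var H.
  exact: eq_bigr psiS.
have -> : \sum_(H in Gs | B \subset H) psi (x H) =
    \sum_(H in Gs | B \subset H) psi_var H.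
  by apply: eq_bigr => H /andP[HG _]; apply: psi_x.
have [BeG|BnG] := eqVneq B G.
  rewrite BeG; apply: keel_top => [|H HS]; last by rewrite -BeG SB.
  apply/subsetP => H HS; rewrite !inE (subsetP SG) // andbT.
  by have := SB H HS; rewrite BeG properEneq => /andP[].
have BG' : B \in Gs' by rewrite !inE BnG.
rewrite sum_psi_var //.
have low : S \subset Gs' -> (forall H, H \in S -> H \notin Hs) ->
    KI (\prod_(H in S) psi_var H * (y' B)%:P ^+ rk_gap M S B).
  move=> SG' SnH; rewrite (eq_bigr (fun H => (x' H)%:P)) => [|H HS]; last first.
    by rewrite psi_var_notin ?SnH ?(subsetP SG').
  rewrite -rmorph_prod -rmorphXn -rmorphM; apply: keel_idealC => //.
    exact: chow_sub_centre.
  by apply: chow_mem => //; rewrite addnC -leq_subLR.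
have [BsG|BsG] := boolP (B \subset G).
  apply: low.
    apply/subsetP => H HS; rewrite !inE (subsetP SG) // andbT.
    apply: contraTneq (SB H HS) => ->; rewrite properE negb_and BsG orbT //.
  move=> H HS; apply/negP => /hsP[_ _ maxH].
  have := SB H HS; rewrite properE => /andP[HB /negP[]].
  by rewrite -(maxH B BG' BsG HB).
pose S0 := [set H in S | ~~ (H \subset G)].
have S0S : S0 \subset S by apply/subsetP => H; rewrite inE => /andP[].
have S0G : S0 \subset Gs'.
  apply/subsetP => H; rewrite inE => /andP[HS HsG].
  by apply: in_Gs' => //; apply: (subsetP SG).
have S0E : \prod_(H in S0) psi_var H = (\prod_(H in S0) x' H)%:P.
  rewrite rmorph_prod; apply: eq_bigr => H HS0; apply: psi_var_notin.
    exact: (subsetP S0G).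
  by move: HS0; rewrite inE => /andP[_]; apply: contra => /hsP[].
have JS0 : J (\prod_(H in S0) x' H * y' B ^+ rk_gap M S B).
  apply: centre_ideal_high => // [H /(subsetP S0S)|]; first exact: SB.
  by rewrite /join_gap bigcupU_not_sub; apply: join_gap_le.
(* Beside ['X] it suffices to be in [J], so members of [S] below [G] can be discarded. *)
have highX w : KI (w * 'X * \prod_(H in S0) psi_var H * (y' B)%:P ^+ rk_gap M S B).
  rewrite -!mulrA; apply: idealMl => //.
  by rewrite S0E -rmorphXn -rmorphM; apply: keel_idealXC.
have [GS|GS] := boolP (G \in S).
  have [|u ->] := @prod_sub _ _ (G |: S0) S psi_var.
    by rewrite subUset sub1set GS.
  rewrite big_setU1 /=; last by rewrite inE subxx andbF.
  by rewrite {1}/psi_var eqxx mulrA; apply: highX.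
have SG' : S \subset Gs'.
  apply/subsetP => H HS; rewrite !inE (subsetP SG) // andbT.
  by apply: contraNneq GS => <-.
rewrite (eq_bigr (fun H => (x' H)%:P + (- (H \in Hs)%:R) * 'X)); last first.
  by move=> H HS; apply/psi_var_in/(subsetP SG').
rewrite (bigID (fun H : {set E} => H \subset G)) /=.
have [u ->] := prodDE (index_enum {set E}) (fun H => (H \in S) && (H \subset G))
   (fun H => (x' H)%:P) (fun H => - (H \in Hs)%:R) 'X.
have -> : \prod_(H in S | ~~ (H \subset G)) ((x' H)%:P + - (H \in Hs)%:R * 'X) =
    \prod_(H in S0) psi_var H.
  apply: eq_big => [H|H /andP[HS _]]; first by rewrite inE.
  by rewrite psi_var_in // (subsetP SG').
rewrite mulrDl mulrDl; apply: idealD => //; last by rewrite ['X * u]mulrC; apply: highX.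
rewrite S0E -!rmorph_prod -rmorphM -rmorphXn -rmorphM.
rewrite (_ : _ * \prod_(H in S0) x' H = \prod_(H in S) x' H); last first.
  rewrite [RHS](bigID (fun H : {set E} => H \subset G)) /=; congr (_ * _).
  by apply: eq_bigl => H; rewrite inE.
apply: keel_idealC => //; first exact: chow_sub_centre.
by apply: chow_mem => //; rewrite addnC -leq_subLR.
Qed.

Lemma piC c : pi c%:MP = c%:MP. Proof. exact: mmapC. Qed.

Lemma pi_homog d p : p \is d.-homog -> pi p \is d.-homog.
Proof.
apply: mmap_homog => i; rewrite /= /blow_var rpredD ?cvar_homog //.
by rewrite mulr_natl rpredMn ?cvar_homog.
Qed.

Lemma psi_xG : psi (x G) = 'X. Proof. by rewrite psi_x // /psi_var eqxx. Qed.

Lemma psi_pi p : psi (pi p) = p%:P.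
Proof.
apply: (mpoly_morph_ext (f1 := psi \o pi) (f2 := polyC)) => [c|i] /=.
  by rewrite piC; apply: mmapC.
have HG : bflat i \in Gs' by apply: enum_valP.
rewrite -[X in pi X]cvar_bflat pi_x // /blow_var rmorphD rmorphM rmorph_nat /= psi_xG.
by rewrite psi_x ?sub_Gs // psi_var_in // mulNr subrK cvar_bflat.
Qed.

Lemma var_pi i : exists u c, u \is 1.-homog /\ 'X_i = pi u + c *: x G.
Proof.
have HG : bflat i \in Gs by apply: enum_valP.
rewrite -cvar_bflat; have [->|HnG] := eqVneq (bflat i) G.
  by exists 0, 1; rewrite dhomog0 rmorph0 add0r scale1r.
have HG' : bflat i \in Gs' by rewrite !inE HnG.
exists (x' (bflat i)), (- (bflat i \in Hs)%:R); split; first exact: cvar_homog.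
by rewrite pi_x // /blow_var scaleNr scaler_nat mulr_natl addrK.
Qed.

Lemma hs_vars_homog : {in hs_vars, forall p, p \is 1.-homog}.
Proof. by move=> p /mapP[h _ ->]; apply: cvar_homog. Qed.

Lemma blow_up_hdim d a b : hdim I' d a -> (forall m, hdim J m (b m)) ->
  hdim I d (a + \sum_(1 <= i < #|Hs|) (if i <= d then b (d - i) else 0))%N.
Proof.
have szE : size hs_vars = #|Hs| by rewrite size_map cardE.
move=> ha hb; rewrite -szE.
apply: (keel_hdim II II' IJ (pi := pi) (psi := psi) (t := x G)) => //.
- exact: piC.
- exact: psi_pi.
- exact: psi_xG.
- exact: pi_homog.
- exact: cvar_homog.
- exact: hs_vars_homog.
- exact: var_pi.
- exact: pi_chow.
- exact: pi_centre.
- exact: prod_hs_chow.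
- exact: prod_hs_centre.
- exact: psi_chow.
- by rewrite szE hs_card_gt0.
Qed.

(** * The Chow rings of [M|G] and [M/G] labelled by subsets of [E] *)

Local Notation RB := (restr_bs G Gs').
Local Notation CB := (contr_bs M G Gs').
Local Notation Q1 := {mpoly rat[#|RB|]}.
Local Notation Q2 := {mpoly rat[#|CB|]}.
Local Notation Q12 := {mpoly Q1[#|CB|]}.

Definition restr_set H : {set {z : E | z \in G}} := [set z | val z \in H].
Definition contr_set H : {set {z : E | z \notin G}} := [set z | val z \in H].

Lemma val_restr_set H : H \subset G -> val @: restr_set H = H.
Proof.
move=> HG; apply/setP => z; apply/imsetP/idP => [[u + ->]|zH].
  by rewrite inE.
by exists (exist _ z (subsetP HG z zH)); rewrite ?inE.
Qed.

Lemma val_contr_set H : val @: contr_set H :|: G = H :|: G.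
Proof.
apply/setP => z; rewrite !inE; case: (boolP (z \in G)) => zG; first by rewrite !orbT.
rewrite !orbF; apply/imsetP/idP => [[u + ->]|zH]; first by rewrite inE.
by exists (exist _ z zG); rewrite ?inE.
Qed.

Lemma val_bigcup (P : pred E) (T : finType) (S : {set T}) (F : T -> {set {z | P z}}) :
  val @: (\bigcup_(i in S) F i) = \bigcup_(i in S) (val @: F i).
Proof.
apply/setP => z; apply/imsetP/bigcupP => [[u /bigcupP[i iS ui] ->]|[i iS]].
  by exists i => //; apply: imset_f.
by case/imsetP=> u ui ->; exists u => //; apply/bigcupP; exists i.
Qed.

Definition restr_label (i : 'I_#|RB|) : {set E} := val @: bflat i.

Lemma restr_label_inj : injective restr_label.
Proof. by move=> i j /(imset_inj val_inj) /bflat_inj. Qed.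

Lemma restr_bflatP (i : 'I_#|RB|) : exists2 H, H \in below Gs' G & bflat i = restr_set H.
Proof.
have : bflat i \in RB by apply: enum_valP.
by case/imsetP=> H HG ->; exists H.
Qed.

Lemma restr_label_set : label_set restr_label = below Gs' G.
Proof.
apply/setP => H; apply/imsetP/idP => [[i _ ->]|HG].
  rewrite /restr_label; have [K KG ->] := restr_bflatP i; rewrite val_restr_set //.
  by move: KG; rewrite inE => /andP[].
have HR : restr_set H \in RB by apply: imset_f.
exists (enum_rank_in HR (restr_set H)) => //.
rewrite /restr_label /bflat enum_rankK_in // val_restr_set //.
by move: HG; rewrite inE => /andP[].
Qed.

Lemma restr_label_rel : labelled_rel restr_label (rk_gap M) (chow_rel (restr M G) (Bs := RB)).
Proof.
apply: chow_rel_labelled => [b i|S b _].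
  apply/idP/idP; first exact: imsetS.
  move=> /subsetP bi; apply/subsetP => u ub.
  by have /imsetP[v vi /val_inj ->] := bi _ (imset_f val ub).
rewrite /rk_gap big_imset /= => [|i j _ _]; last exact: restr_label_inj.
by rewrite /restr_rk val_bigcup.
Qed.

(** Several elements of [Gs'] may have the same image in [M/G]; the good one is the label. The
    default [set0] is never reached, by [contr_labelP]. *)
Definition contr_label (j : 'I_#|CB|) : {set E} :=
  odflt set0 [pick H | good H && (bflat j == contr_set (cl (H :|: G)))].

Lemma contr_labelP j : good (contr_label j) /\ bflat j = contr_set (cl (contr_label j :|: G)).
Proof.
have : bflat j \in CB by apply: enum_valP.
case/imsetP=> B; rewrite inE => /andP[BG BsG] jE.
rewrite /contr_label; case: pickP => [H /andP[gH /eqP]//|no].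
have [C gC [_ clE]] := good_rep BG BsG.
by have := no C; rewrite gC jE /contr_set clE eqxx.
Qed.

Lemma contr_set_sub H K : G \subset K ->
  (contr_set H \subset contr_set K) = (H \subset K).
Proof.
move=> GK; apply/subsetP/subsetP => HK z; last by rewrite !inE; apply: HK.
move=> zH; have [zG|zG] := boolP (z \in G); first exact: (subsetP GK).
by have := HK (exist _ z zG); rewrite !inE; apply.
Qed.

Lemma good_clU_sub H K : good H -> good K ->
  (cl (H :|: G) \subset cl (K :|: G)) = (H \subset K).
Proof.
move=> gH gK; have [HG HsG _] := goodP gH; apply/idP/idP => HK.
  by apply: good_max => //; apply: subset_trans HK; rewrite sub_clU.
apply: cl_sub; first exact: flat_cl.
by apply: subset_trans (sub_cl M _); rewrite setSU.
Qed.

Lemma contr_label_sub (i j : 'I_#|CB|) : (bflat i \subset bflat j) = (contr_label i \subset contr_label j).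
Proof.
have [gi ->] := contr_labelP i; have [gj ->] := contr_labelP j.
by rewrite contr_set_sub ?sub_clU // good_clU_sub.
Qed.

Lemma contr_label_inj : injective contr_label.
Proof.
move=> i j ij; apply: bflat_inj; apply/eqP.
by rewrite eqEsubset !contr_label_sub ij subxx.
Qed.

Lemma contr_label_set : label_set contr_label = [set H | good H].
Proof.
apply/setP => H; rewrite inE; apply/imsetP/idP => [[j _ ->]|gH].
  by have [] := contr_labelP j.
have [HG HsG _] := goodP gH.
have HC : contr_set (cl (H :|: G)) \in CB.
  by apply/imsetP; exists H; rewrite // inE HG.
pose j := enum_rank_in HC (contr_set (cl (H :|: G))).
have jE : bflat j = contr_set (cl (H :|: G)) by rewrite /bflat enum_rankK_in.
have [gj] := contr_labelP j; rewrite jE => cE; exists j; first by [].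
apply/eqP.
rewrite eqEsubset -(good_clU_sub gH gj) -(good_clU_sub gj gH).
rewrite -(contr_set_sub (cl (H :|: G))) ?sub_clU // cE.
by rewrite -(contr_set_sub (cl (contr_label j :|: G))) ?sub_clU // -cE subxx.
Qed.

Lemma rk_bigcup_clU (T : finType) (S : {set T}) (F : T -> {set E}) :
  rk M (\bigcup_(i in S) cl (F i :|: G) :|: G) = rk M (\bigcup_(i in S) F i :|: G).
Proof.
apply/eqP; rewrite eqn_leq -[X in (_ <= X)%N]rk_cl !rk_mono //.
  apply: setSU; apply/bigcupsP => i iS.
  by apply: subset_trans (bigcup_sup i iS); rewrite sub_clU.
rewrite subUset sub_clU andbT; apply/bigcupsP => i iS.
apply: cl_sub; first exact: flat_cl.
apply: subset_trans (sub_cl M _); apply: setSU; exact: bigcup_sup.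
Qed.

Lemma contr_label_rel : labelled_rel contr_label join_gap (chow_rel (contr M G) (Bs := CB)).
Proof.
apply: chow_rel_labelled => [b i|S b _]; first exact: contr_label_sub.
rewrite /join_gap big_imset /= => [|i j _ _]; last exact: contr_label_inj.
have clE (i : 'I_#|CB|) : val @: bflat i :|: G = cl (contr_label i :|: G).
  have [_ ->] := contr_labelP i; rewrite val_contr_set; apply/setUidPl.
  by rewrite sub_clU.
have SE : val @: (\bigcup_(i in S) bflat i) :|: G =
    \bigcup_(i in S) cl (contr_label i :|: G) :|: G.
  rewrite val_bigcup; apply/eqP; rewrite eqEsubset !subUset !subsetUr !andbT.
  apply/andP; split; apply/bigcupsP => i iS.
    apply: subset_trans (subsetUl _ _); apply: subset_trans (bigcup_sup i iS).
    by rewrite -clE subsetUl.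
  by rewrite -clE setSU //; apply: (bigcup_sup i).
rewrite /contr_rk clE SE rk_bigcup_clU rk_cl subnBA; last first.
  by apply: rk_mono; apply: subsetUr.
by rewrite subnK //; apply: rk_mono; apply: subsetUr.
Qed.

(** * The centre as a tensor product *)

Local Notation w := (lvar rat restr_label).
Local Notation z := (lvar rat contr_label).
Local Notation I1 := (@chow_ideal _ (restr M G) RB).
Local Notation I2 := (@chow_ideal _ (contr M G) CB).
Local Notation inj2 := (@tensor_inr rat #|RB| #|CB|).
Local Notation TI := (tensor_ideal I1 I2).

Let II1 : is_ideal I1 := @chow_ideal_ideal _ (restr M G) RB.
Let II2 : is_ideal I2 := @chow_ideal_ideal _ (contr M G) CB.
Let IT : is_ideal TI := tensor_ideal_ideal II1 II2.

Lemma w_notin H : ~~ (H \subset G) -> w H = 0.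
Proof. by move=> HG; rewrite lvar_notin // restr_label_set inE negb_and HG orbT. Qed.

Lemma z_notin H : ~~ good H -> z H = 0.
Proof. by move=> HG; rewrite lvar_notin // contr_label_set inE. Qed.

Lemma z_sub H : H \subset G -> z H = 0.
Proof. by move=> HG; rewrite z_notin // /good HG andbF. Qed.

Lemma hs_notin H : ~~ (H \subset G) -> (H \in Hs) = false.
Proof. by move=> HG; apply: contraNF HG => /hsP[]. Qed.

Lemma Gs'_not_sub K : K \in Gs' -> G \subset K -> ~~ (K \subset G).
Proof. by move=> KG GK; have /goodP[] := good_super KG GK. Qed.

Lemma restr_label_sub_Gs' : label_set restr_label \subset Gs'.
Proof. by rewrite restr_label_set; apply/subsetP => H; rewrite inE => /andP[]. Qed.

Lemma contr_label_sub_Gs' : label_set contr_label \subset Gs'.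
Proof. by rewrite contr_label_set; apply/subsetP => H; rewrite inE => /goodP[]. Qed.

Definition top_z : Q2 := \sum_(K in Gs' | G \subset K) z K.
Definition top_x : Q' := \sum_(K in Gs' | G \subset K) x' K.

(** For [B] below [G], the sum [y' B] is, modulo bad variables, its part below [G] plus [top_x],
    whereas [M|G] sees only the former. Since exactly one factor lies above [B], shifting the factor
    variables by [top_x] makes up the difference. *)
Definition sig_var H : Q' := x' H + (H \in Hs)%:R * top_x.
Definition sig : Q1 -> Q' := mmap (@mpolyC #|Gs'| rat) (sig_var \o restr_label).
HB.instance Definition _ := GRing.RMorphism.on sig.

Definition tau : Q2 -> Q' := mmap (@mpolyC #|Gs'| rat) (x' \o contr_label).
HB.instance Definition _ := GRing.RMorphism.on tau.

(** One formula for the three cases of [trichotomy]: [w H] vanishes unless [H] is below [G], and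
    [z H] unless [H] is good, so bad elements go to 0. The term in [top_z] undoes the shift in
    [sig_var]. *)
Definition rho_var H : Q12 := (w H)%:MP - (H \in Hs)%:R * inj2 top_z + inj2 (z H).
Definition rho : Q' -> Q12 :=
  mmap (@mpolyC #|CB| Q1 \o @mpolyC #|RB| rat) (rho_var \o @bflat E Gs').
HB.instance Definition _ := GRing.RMorphism.on rho.

Lemma sig_w H : H \in Gs' -> H \subset G -> sig (w H) = sig_var H.
Proof.
move=> HG HsG; rewrite /sig mmap_lvar //; first exact: restr_label_inj.
by rewrite restr_label_set inE HG.
Qed.

Lemma tau_z H : good H -> tau (z H) = x' H.
Proof.
move=> gH; rewrite /tau mmap_lvar //; first exact: contr_label_inj.
by rewrite contr_label_set inE.
Qed.

Lemma rho_x H : H \in Gs' -> rho (x' H) = rho_var H.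
Proof. by move=> HG; rewrite /rho mmap_cvar. Qed.

Lemma rho_var_good H : ~~ (H \subset G) -> rho_var H = inj2 (z H).
Proof. by move=> HG; rewrite /rho_var w_notin // hs_notin // mul0r subr0 mpolyC0 add0r. Qed.

Lemma rho_var_bad H : bad H -> rho_var H = 0.
Proof.
move=> bH; have [_ HsG _ _] := badP bH; rewrite rho_var_good // z_notin ?rmorph0 //.
by rewrite /good bH !andbF.
Qed.

Lemma rho_var_low H : H \subset G -> H \notin Hs -> rho_var H = (w H)%:MP.
Proof.
by move=> HG /negPf Hh; rewrite /rho_var Hh mul0r subr0 z_sub // rmorph0 addr0.
Qed.

Lemma sum_rho_var B : B \in Gs' -> \sum_(H in Gs' | B \subset H) rho (x' H) =
  (\sum_(H in Gs' | B \subset H) w H)%:MP - (B \subset G)%:R * inj2 top_z +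
  inj2 (\sum_(H in Gs' | B \subset H) z H).
Proof.
move=> BG; rewrite (eq_bigr rho_var) => [|H /andP[HG _]]; last exact: rho_x.
rewrite !big_split /= sumrN -mulr_suml hs_count //.
by rewrite !rmorph_sum.
Qed.

(** A good element above [B] meets [G] and therefore contains it, so the [z] part of the sum is
    [top_z]; the correction at the one factor above [B] cancels it. *)
Lemma rho_y_low B : B \in Gs' -> B \subset G ->
  \sum_(H in Gs' | B \subset H) rho (x' H) =
  (\sum_(H in label_set restr_label | B \subset H) w H)%:MP.
Proof.
move=> BG BsG; rewrite sum_rho_var // BsG mul1r -(sum_lvar _ _ restr_label_sub_Gs').
suff -> : \sum_(H in Gs' | B \subset H) z H = top_z by rewrite subrK.
have [t tB] := set0Pn _ (bs_neq0 bG' BG).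
rewrite (sum_lvar _ _ contr_label_sub_Gs') /top_z (sum_lvar _ _ contr_label_sub_Gs').
apply: eq_bigl => H; rewrite contr_label_set inE; case: (boolP (good H)) => //= gH.
apply/idP/idP => [BH|]; last exact: subset_trans.
exact: good_meet gH (subsetP BH _ tB) (subsetP BsG _ tB).
Qed.

Lemma rho_y_high B C : B \in Gs' -> ~~ (B \subset G) -> good C -> B \subset C ->
  cl (C :|: G) = cl (B :|: G) ->
  \sum_(H in Gs' | B \subset H) rho (x' H) =
  inj2 (\sum_(H in label_set contr_label | C \subset H) z H).
Proof.
move=> BG BsG gC BC clE; rewrite sum_rho_var // (negPf BsG) mul0r subr0.
have -> : \sum_(H in Gs' | B \subset H) w H = 0.
  apply: big1 => H /andP[_ BH]; apply: w_notin; apply: contra BsG.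
  exact: subset_trans.
rewrite mpolyC0 add0r (sum_lvar _ _ contr_label_sub_Gs'); congr (inj2 _); apply: eq_bigl => H.
rewrite contr_label_set inE; case: (boolP (good H)) => //= gH.
by apply: good_sub_rep => //; have [] := goodP gC.
Qed.

Lemma rho_centre p : J p -> TI (rho p).
Proof.
have IIt : is_ideal (fun p => TI (rho p)).
  split=> [|a b Ia Ib|a b Ib]; first by rewrite rmorph0; exact: (ideal0 IT).
    by rewrite rmorphD; exact: (idealD IT Ia Ib).
  by rewrite rmorphM; exact: (idealMl IT _ Ib).
apply: ideal_span_sub IIt _ p => p; case=> [H bH|S B BG BsG SG SB|S B BG BsG SG SB SsG].
- by rewrite rho_x; [rewrite rho_var_bad //; apply: (ideal0 IT)|have [] := badP bH].
- rewrite rmorphM rmorphXn rmorph_prod rmorph_sum /= rho_y_low //.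
  have -> : \prod_(H in S) rho (x' H) = (\prod_(H in S) w H)%:MP.
    rewrite rmorph_prod; apply: eq_bigr => H HS; have HB := SB H HS.
    have HsG := subset_trans (proper_sub HB) BsG.
    rewrite rho_x ?(subsetP SG) // rho_var_low //; apply/negP => /hsP[_ _ maxH].
    have HE := maxH B BG BsG (proper_sub HB).
    by move: HB; rewrite HE properxx.
  rewrite -rmorphXn -rmorphM; apply: tensor_ideal1 => //.
  apply: (lchow_mem restr_label_inj restr_label_rel) => //; rewrite /below_strict restr_label_set.
  rewrite inE BG BsG /=; apply/andP; split; last exact/forall_inP.
  apply/subsetP => H HS; rewrite inE (subsetP SG) //=.
  exact: subset_trans (proper_sub (SB H HS)) BsG.
rewrite rmorphM rmorphXn rmorph_prod rmorph_sum /=.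
have [/exists_inP[H HS bH]|] := boolP [exists H in S, bad H].
  rewrite (bigD1 H) //= rho_x ?(subsetP SG) // rho_var_bad // !mul0r.
  exact: (ideal0 IT).
rewrite negb_exists_in => /forall_inP Snb.
have Sg H : H \in S -> good H.
  by move=> HS; rewrite /good (subsetP SG) // SsG // Snb.
(* [B] itself may be bad; its good representative has the same join with [G] and the same good
   elements above it. *)
have [C gC [BC clE]] := good_rep BG BsG.
rewrite (rho_y_high BG BsG gC BC clE).
have -> : \prod_(H in S) rho (x' H) = inj2 (\prod_(H in S) z H).
  rewrite rmorph_prod; apply: eq_bigr => H HS.
  by rewrite rho_x ?(subsetP SG) // rho_var_good // SsG.
rewrite -rmorphXn -rmorphM; apply: tensor_ideal2 => //.
apply: (lchow_mem contr_label_inj contr_label_rel); last first.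
  by rewrite /join_gap -(rk_cl M (C :|: G)) clE rk_cl.
rewrite /below_strict contr_label_set inE gC /=; apply/andP; split.
  by apply/subsetP => H /Sg; rewrite inE.
by apply/forall_inP => H /SB HB; apply: proper_sub_trans HB BC.
Qed.

Lemma sig_restr p : I1 p -> J (sig p).
Proof.
apply: (lchow_map restr_label_inj restr_label_rel IJ) => S B.
rewrite /below_strict restr_label_set => /and3P[]; rewrite inE => /andP[BG BsG] SG.
move=> /forall_inP SB.
have SG' : S \subset Gs'.
  by apply: subset_trans SG _; rewrite -restr_label_set restr_label_sub_Gs'.
have -> : \prod_(H in S) sig (w H) = \prod_(H in S) x' H.
  apply: eq_bigr => H HS; have HB := SB H HS.
  have HsG := subset_trans (proper_sub HB) BsG.
  rewrite sig_w ?(subsetP SG') // /sig_var.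
  case: (boolP (H \in Hs)) => [/hsP[_ _ maxH]|]; last by rewrite mul0r addr0.
  have HE := maxH B BG BsG (proper_sub HB).
  by move: HB; rewrite HE properxx.
have -> : \sum_(H in below Gs' G | B \subset H) sig (w H) =
    \sum_(H in below Gs' G | B \subset H) x' H + top_x.
  rewrite (eq_bigr sig_var) => [|H /andP[+ _]]; last first.
    by rewrite inE => /andP[HG HsG]; apply: sig_w.
  rewrite big_split /= -mulr_suml; congr (_ + _).
  rewrite [X in X * _](_ : _ = 1) ?mul1r //.
  transitivity (\sum_(H in Gs' | B \subset H) (H \in Hs)%:R : Q'); last first.
    by rewrite hs_count // BsG.
  rewrite [RHS](bigID (fun H : {set E} => H \subset G)) /= [X in _ = _ + X]big1.
    by rewrite addr0; apply: eq_bigl => H; rewrite inE andbAC.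
  by move=> H /andP[_ HG]; rewrite hs_notin.
apply: (ideal_eq IJ (b := (\prod_(H in S) x' H) * y' B ^+ rk_gap M S B)); last first.
  exact/ideal_span_gen/centre_low.
rewrite -mulrBr; apply: ideal_exp_congr => //; apply: idealMl => //.
rewrite -opprB; apply: idealN => //.
(* The elements above [B] lie below [G], lie above [G], or do neither; the last kind meets [G] in a
   nonempty set and is therefore bad. *)
have -> : y' B = \sum_(H in below Gs' G | B \subset H) x' H + top_x +
    \sum_(H in Gs' | [&& B \subset H, ~~ (H \subset G) & ~~ (G \subset H)]) x' H.
  rewrite /csum (bigID (fun H : {set E} => H \subset G)) /= -addrA; congr (_ + _).
    by apply: eq_bigl => H; rewrite [H \in below _ _]inE andbAC.
  rewrite (bigID (fun H : {set E} => G \subset H)) /=; congr (_ + _).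
    apply: eq_bigl => H; apply/andP/andP => [[/andP[/andP[-> _] _] ->]//|[HG GH]].
    by rewrite HG (subset_trans BsG GH) Gs'_not_sub.
  by apply: eq_bigl => H; rewrite -!andbA.
rewrite addrC addKr; apply: ideal_sum => // H /and4P[HG BH HsG GH].
apply: centre_ideal_bad; rewrite /bad HG HsG GH /=.
have [t tB] := set0Pn _ (bs_neq0 bG' BG).
exact: meet_clU HG HsG (subsetP BH _ tB) (subsetP BsG _ tB).
Qed.

Lemma tau_contr p : I2 p -> J (tau p).
Proof.
apply: (lchow_map contr_label_inj contr_label_rel IJ) => S B.
rewrite /below_strict contr_label_set => /and3P[]; rewrite inE => gB SG /forall_inP SB.
have Sg H : H \in S -> good H by move=> /(subsetP SG); rewrite inE.
have [BG BsG _] := goodP gB.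
have -> : \prod_(H in S) tau (z H) = \prod_(H in S) x' H.
  by apply: eq_bigr => H /Sg; apply: tau_z.
have -> : \sum_(H in [set H | good H] | B \subset H) tau (z H) =
    \sum_(H in Gs' | (B \subset H) && good H) x' H.
  apply: eq_big => [H|H /andP[+ _]]; last by rewrite inE; apply: tau_z.
  rewrite inE; case: (boolP (good H)) => [/goodP[-> _ _]|_]; last by rewrite !andbF.
  by rewrite andbT.
apply: (ideal_eq IJ (b := (\prod_(H in S) x' H) * y' B ^+ join_gap S B)); last first.
  apply/ideal_span_gen/centre_high => //.
    by apply/subsetP => H /Sg/goodP[].
  by move=> H /Sg/goodP[].
rewrite -mulrBr; apply: ideal_exp_congr => //; apply: idealMl => //.
rewrite -opprB; apply: idealN => //.
have -> : y' B = \sum_(H in Gs' | (B \subset H) && good H) x' H +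
    \sum_(H in Gs' | (B \subset H) && ~~ good H) x' H.
  by rewrite /csum (bigID good) /=; congr (_ + _); apply: eq_bigl => H;
    rewrite andbA.
rewrite addrC addKr; apply: ideal_sum => // H /and3P[HG BH nH].
apply: centre_ideal_bad; have [HsG| |//] := trichotomy HG; last by rewrite (negPf nH).
by case/negP: BsG; apply: subset_trans HsG.
Qed.

Lemma sigC c : sig c%:MP = c%:MP. Proof. exact: mmapC. Qed.
Lemma tauC c : tau c%:MP = c%:MP. Proof. exact: mmapC. Qed.
Lemma rhoC c : rho c%:MP = c%:MP%:MP. Proof. exact: mmapC. Qed.

Lemma rho_top_x : rho top_x = inj2 top_z.
Proof.
rewrite !rmorph_sum; apply: eq_bigr => K /andP[KG GK] /=.
by rewrite rho_x // rho_var_good // Gs'_not_sub.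
Qed.

Lemma rho_sig p : rho (sig p) = p%:MP.
Proof.
apply: (mpoly_morph_ext (f1 := rho \o sig) (f2 := @mpolyC #|CB| Q1)) => [c|i] /=.
  by rewrite sigC rhoC.
have : restr_label i \in label_set restr_label by apply: ell_in.
rewrite restr_label_set inE => /andP[HG HsG]; rewrite -(lvar_ell rat restr_label_inj).
rewrite sig_w // /sig_var rmorphD rmorphM rmorph_nat /= rho_top_x rho_x //.
by rewrite /rho_var z_sub // rmorph0 addr0 subrK.
Qed.

Lemma rho_tau p : rho (tau p) = inj2 p.
Proof.
apply: (mpoly_morph_ext (f1 := rho \o tau) (f2 := inj2)) => [c|j] /=.
  by rewrite tauC rhoC /tensor_inr map_mpolyC.
have : contr_label j \in label_set contr_label by apply: ell_in.
rewrite contr_label_set inE => gH; have [HG HsG _] := goodP gH.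
by rewrite -(lvar_ell rat contr_label_inj) tau_z // rho_x // rho_var_good.
Qed.

Lemma top_x_homog : top_x \is 1.-homog.
Proof. by apply: rpred_sum => K _; apply: cvar_homog. Qed.

Lemma sig_homog d p : p \is d.-homog -> sig p \is d.-homog.
Proof.
apply: mmap_homog => i; rewrite /= /sig_var rpredD ?cvar_homog //.
by rewrite mulr_natl rpredMn ?top_x_homog.
Qed.

Lemma tau_homog d p : p \is d.-homog -> tau p \is d.-homog.
Proof. by apply: mmap_homog => i; apply: cvar_homog. Qed.

Lemma tau_top_z : tau top_z = top_x.
Proof.
rewrite rmorph_sum; apply: eq_bigr => K /andP[KG GK]; apply: tau_z.
exact: good_super.
Qed.

Lemma var_sig_tau i : exists u v,
  [/\ u \is 1.-homog, v \is 1.-homog & J ('X_i - (sig u + tau v))].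
Proof.
have HG : bflat i \in Gs' by apply: enum_valP.
rewrite -cvar_bflat; move: (bflat i) HG => H HG.
have [HsG|gH|bH] := trichotomy HG.
- exists (w H), (- ((H \in Hs)%:R * top_z)); split.
  + exact: lvar_homog.
  + rewrite rpredN mulr_natl rpredMn // rpred_sum // => K _; exact: lvar_homog.
  rewrite rmorphN rmorphM rmorph_nat /= tau_top_z sig_w // /sig_var addrK subrr.
  exact: ideal0.
- exists 0, (z H); split; [exact: dhomog0|exact: lvar_homog|].
  by rewrite rmorph0 add0r tau_z // subrr; apply: ideal0.
exists 0, 0; split; [exact: dhomog0|exact: dhomog0|].
by rewrite !rmorph0 addr0 subr0; apply: centre_ideal_bad.
Qed.

Lemma centre_hdim d a b : (forall m, hdim I1 m (a m)) ->
  (forall m, hdim I2 m (b m)) -> hdim J d (\sum_(i < d.+1) a i * b (d - i))%N.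
Proof.
move=> ha hb.
have hc : homog_closed I1.
  exact: ideal_gen_homog_closed (labelled_homog restr_label_rel).
have := tensor_hdim II1 IJ (sig := sig) (tau := tau) (rho := rho) sigC tauC rhoC
  sig_homog tau_homog sig_restr tau_contr rho_centre rho_sig rho_tau hc var_sig_tau.
by apply.
Qed.

Lemma maxel_restr : maxel RB = restr_set @: Hs.
Proof.
have rsS H K : H \subset G -> K \subset G ->
    (restr_set H \subset restr_set K) = (H \subset K).
  move=> HG KG; apply/idP/idP => [|/subsetP HK]; last first.
    by apply/subsetP => t; rewrite !inE; apply: HK.
  by move=> /(imsetS val); rewrite !val_restr_set.
apply/setP => R; rewrite inE; apply/andP/imsetP => [[]|[H HH ->]].
  case/imsetP=> H HG ->; rewrite -/(restr_set H) => /forall_inP maxR.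
  exists H => //; rewrite inE HG; apply/forall_inP => K KG.
  have := maxR (restr_set K) (imset_f _ KG); move: HG KG.
  by rewrite !inE !properE => /andP[_ HsG] /andP[_ KsG]; rewrite !rsS.
have [HG HsG maxH] := hsP HH; split; first by apply: imset_f; rewrite inE HG.
apply/forall_inP => _ /imsetP[K + ->]; rewrite inE => /andP[KG KsG].
rewrite -/(restr_set K) properE !rsS // negb_and negbK.
by case: (boolP (H \subset K)) => //= HK; rewrite (maxH K).
Qed.

Lemma card_maxel_restr : #|maxel RB| = #|Hs|.
Proof.
rewrite maxel_restr card_in_imset // => H K /hsP[_ HG _] /hsP[_ KG _] HK.
by rewrite -(val_restr_set HG) HK val_restr_set.
Qed.

End RemoveElement.

Theorem theorem5p1 (E : finType) (M : matroid E) (Gs : {set {set E}})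
    (G : {set E}) :
  loopless M ->
  building_set M Gs ->
  G \in Gs ->
  building_set M (Gs :\ G) ->
  let Gs' := Gs :\ G in
  let k := #|maxel (restr_bs G Gs')| in
  hilb M Gs =
    hilb M Gs' +
    (\sum_(1 <= i < k) 'X^i) *
      hilb (restr M G) (restr_bs G Gs') *
      hilb (contr M G) (contr_bs M G Gs') :> {poly nat}.
Proof.
move=> loopM bG GG bG' Gs' k; apply/polyP => d.
(* Both coefficients are dimensions of the degree [d] piece of D(M, Gs), one by definition and one
   by the basis from the blow-up. *)
apply: (hdim_uniq (@chow_ideal_ideal E M Gs) (hilb_hdim M Gs d)).
have hJ m := centre_hdim loopM bG GG bG' m (hilb_hdim (restr M G) (restr_bs G Gs'))
  (hilb_hdim (contr M G) (contr_bs M G Gs')).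
have := blow_up_hdim loopM bG GG bG' (hilb_hdim M Gs' d) hJ.
rewrite coefD -mulrA mulr_suml coef_sum /k card_maxel_restr //.
congr (hdim _ _ (_ + _)%N); apply: eq_bigr => i _.
by rewrite coefXnM ltnNge; case: ifP => //= _; rewrite coefM.
Qed.
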